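(* Under the standing assumptions (A1)–(A5) in the context, there are constants $C_1,C_2,C_3>0$, depending only on $o_0,h_0,\zeta,q_0$ (in particular independent of $L$ and $M$), such that the following holds for every even $L$ and every nonzero integer $M$ with $|M|\le C_1\sqrt V$. The state $|\Gamma_L^M\rangle$ is well-defined (that is, the vector in its numerator is nonzero), and in general $$\langle\Gamma_L^M|\hat H_L|\Gamma_L^M\rangle\le E_L^{\rm gs}+C_3\frac{|M|^3}{V},$$ while if $M_L=0$ one has $$\langle\Gamma_L^M|\hat H_L|\Gamma_L^M\rangle\le E_L^{\rm gs}+C_2\frac{M^2}{V}.$$
   Context: Setting. Fix $d\ge1$. For even $L$ let $\Lambda_L=\{x\in\mathbb Z^d: -L/2<x_i\le L/2\}$ be the hypercubic lattice with periodic boundary conditions and $V=L^d$ sites. The Hilbert space is the tensor product over $x\in\Lambda_L$ of copies of a fixed finite-dimensional Hilbert space; an operator ''acts on'' a set of sites if it is the tensor product of an operator on those sites with the identity elsewhere. $\|\cdot\|$ is the operator norm. The Hamiltonian is $\hat H_L=\sum_{x\in\Lambda_L}\hat h_x$ (self-adjoint), with the $\hat h_x$ translational copies of each other. $E_L^{\rm gs}$ denotes the lowest eigenvalue of $\hat H_L$ and $|\Phi_L^{\rm gs}\rangle$ the normalized ground state. The constants $a,\zeta,h_0,o_0,q_0$ below do not depend on $L$. (A1) There is a self-adjoint $\hat C_L$ with $[\hat C_L,\hat h_x]=0$ for all $x$ (so $[\hat C_L,\hat H_L]=0$), and $-aV\le\hat C_L\le aV$ with a constant $a>0$. (A2) There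 are order operators $\hat{\mathcal O}_L^{(\alpha)}=\sum_{x\in\Lambda_L}\hat o_x^{(\alpha)}$, $\alpha=1,2$, with $\hat o_x^{(\alpha)}$ self-adjoint and translationally invariant (translational copies of each other, under suitable identifications of the single-site spaces), satisfying $[\hat{\mathcal O}_L^{(1)},\hat C_L]=-i\hat{\mathcal O}_L^{(2)}$, $[\hat{\mathcal O}_L^{(2)},\hat C_L]=i\hat{\mathcal O}_L^{(1)}$, $[\hat{\mathcal O}_L^{(1)},\hat{\mathcal O}_L^{(2)}]=i\hat C_L$. (A3) $\hat h_x$ acts on at most $\zeta$ sites including $x$; $\hat o_x^{(1)},\hat o_x^{(2)}$ act only on site $x$. Write $h_0=\|\hat h_x\|$ and $o_0=\|\hat o_x^{(1)}\pm i\hat o_x^{(2)}\|$, independent of $x$. (A4) For each $L$ the ground state $|\Phi_L^{\rm gs}\rangle$ of $\hat H_L$ is unique and $\hat C_L|\Phi_L^{\rm gs}\rangle=M_L|\Phi_L^{\rm gs}\rangle$ for some real $M_L$. (A5) There is a constant $q_0>0$ with $\langle\Phi_L^{\rm gs}|(\hat{\mathcal O}_L^{(1)}/V)^2|\Phi_L^{\rm gs}\rangle=\langle\Phi_L^{\rm gs}|(\hat{\mathcal O}_L^{(2)}/V)^2|\Phi_L^{\rm gs}\rangle\ge q_0$ for all $L$. Let $\hat{\mathcal O}_L^\pm=\hat{\mathcal O}_L^{(1)}\pm i\hat{\mathcal O}_L^{(2)}$. For $M=1,2,\dots$ define $$|\Gamma_L^{M}\rangle=\frac{(\hat{\mathcal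 O}_L^+)^M|\Phi_L^{\rm gs}\rangle}{\|(\hat{\mathcal O}_L^+)^M|\Phi_L^{\rm gs}\rangle\|},\qquad |\Gamma_L^{-M}\rangle=\frac{(\hat{\mathcal O}_L^-)^M|\Phi_L^{\rm gs}\rangle}{\|(\hat{\mathcal O}_L^-)^M|\Phi_L^{\rm gs}\rangle\|}.$$ *)

(* Defs.v *)
From HB Require Import structures.
From mathcomp Require Import all_boot all_order all_algebra.
From mathcomp Require Import classical_sets reals.
From mathcomp Require Export complex.

Set Implicit Arguments.
Unset Strict Implicit.
Unset Printing Implicit Defensive.
Import Order.TTheory GRing.Theory Num.Theory.
Local Open Scope ring_scope.
Local Open Scope sesquilinear_scope.
Local Open Scope complex_scope.

Section FiniteDimension.
Variables (R : realType) (N : nat).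
Implicit Types (A B : 'M[R[i]]_N) (u v : 'cV[R[i]]_N).

Definition braket u v : R[i] := (u^t* *m v) 0 0.

Definition expval v A : R[i] := braket v (A *m v).

Definition ketnorm v : R := Num.sqrt (complex.Re (braket v v)).

Definition opnorm A : R :=
  sup [set r | exists v, ketnorm v = 1 /\ r = ketnorm (A *m v)]%classic.

Definition comm A B : 'M[R[i]]_N := A *m B - B *m A.

(* The order of R[i] makes x <= y imply that y - x is real. *)
Definition op_le A B := forall v, expval v A <= expval v B.

(* [eigenvalue] refers to row vectors; it is only used for Hermitian H, whose
   row eigenvectors are the adjoints of its column eigenvectors. *)
Definition lowest_eigenvalue A (E : R) :=
  eigenvalue A E%:C /\ forall b : R, eigenvalue A b%:C -> E <= b.

Definition unique_ground_state A (E : R) v :=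
  [/\ braket v v = 1,
      A *m v = E%:C *: v
    & forall u, A *m u = E%:C *: u -> exists c : R[i], u = c *: v].

End FiniteDimension.

(* The tensor product over a finite set X of sites of copies of C^n has the
   orthonormal product basis |s>, indexed by s : {ffun X -> 'I_n}. *)
Definition tdim (X : finType) (n : nat) : nat := #|{: {ffun X -> 'I_n}}|.

Section TensorProduct.
Variables (R : realType) (n : nat).

Definition entry (X : finType) (A : 'M[R[i]]_(tdim X n))
  (s t : {ffun X -> 'I_n}) : R[i] := A (enum_rank s) (enum_rank t).

Definition op_of_entries (X : finType)
    (K : {ffun X -> 'I_n} -> {ffun X -> 'I_n} -> R[i]) : 'M[R[i]]_(tdim X n) :=
  \matrix_(i < tdim X n, j < tdim X n) K (enum_val i) (enum_val j).

Definition restr (X : finType) (S : {set X}) (s : {ffun X -> 'I_n}) :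
  {ffun {x | x \in S} -> 'I_n} := [ffun x => s (val x)].

(* B tensored with the identity on the complement of S *)
Definition tensor_id (X : finType) (S : {set X})
    (B : 'M[R[i]]_(tdim {x | x \in S} n)) : 'M[R[i]]_(tdim X n) :=
  op_of_entries (fun s t =>
    if [forall x, (x \notin S) ==> (s x == t x)]
    then entry B (restr S s) (restr S t) else 0).

Definition acts_on (X : finType) (S : {set X}) (A : 'M[R[i]]_(tdim X n)) :=
  exists B : 'M[R[i]]_(tdim {x | x \in S} n), A = tensor_id B.

(* the tensor product over x of the single-site operators U x *)
Definition tensor_op (X : finType) (U : X -> 'M[R[i]]_n) : 'M[R[i]]_(tdim X n) :=
  op_of_entries (fun s t => \prod_x U x (s x) (t x)).

End TensorProduct.

(* For even L > 0 this is the periodic lattice {-L/2 < x_i <= L/2}: each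
   coordinate is represented by its class modulo L, so that + is translation
   with periodic boundary conditions.  ('Z_L is Z/L only when L > 1.) *)
Definition site (d L : nat) : Type := {ffun 'I_d -> 'Z_L}.
HB.instance Definition _ d L := Finite.on (site d L).
HB.instance Definition _ d L := GRing.Zmodule.on (site d L).

Definition volume (d L : nat) : nat := (L ^ d)%N.

Notation operator R d n L := 'M[R[i]]_(tdim (site d L) n).
Notation state R d n L := 'cV[R[i]]_(tdim (site d L) n).

Section Lattice.
Variables (R : realType) (d n L : nat).

Definition shift (y : site d L) (s : {ffun site d L -> 'I_n}) :
  {ffun site d L -> 'I_n} := [ffun x => s (x + y)].

(* The copy of A obtained by moving every site x to x + y *)
Definition translate (y : site d L) (A : operator R d n L) : operator R d n L :=
  op_of_entries (fun s t => entry A (shift y s) (shift y t)).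

Definition translational_copies (A : site d L -> operator R d n L) :=
  forall x y, A (x + y) = translate y (A x).

(* U x identifies the space at site x with the common single-site space. *)
Definition copies_under (U : site d L -> 'M[R[i]]_n)
    (A : site d L -> operator R d n L) :=
  translational_copies (fun x => tensor_op U *m A x *m (tensor_op U)^t*).

Record model := Model {
  ham : site d L -> operator R d n L;   (* h_x *)
  local1 : site d L -> operator R d n L;  (* o_x^(1) *)
  local2 : site d L -> operator R d n L;  (* o_x^(2) *)
  charge : operator R d n L;            (* C_L *)
  gsE : R;                              (* E_L^gs *)
  gs : state R d n L;                   (* Phi_L^gs *)
  gsM : R                               (* M_L *)
}.

Variable m : model.

Definition Ham : operator R d n L := \sum_x ham m x.
Definition Ord1 : operator R d n L := \sum_x local1 m x.
Definition Ord2 : operator R d n L := \sum_x local2 m x.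
Definition OrdP : operator R d n L := Ord1 + 'i *: Ord2.
Definition OrdM : operator R d n L := Ord1 - 'i *: Ord2.

Definition hamiltonian_setting :=
  [/\ Ham \is hermsymmx, translational_copies (ham m)
    & lowest_eigenvalue Ham (gsE m)].

Definition A1 (a : R) :=
  [/\ charge m \is hermsymmx,
      forall x, comm (charge m) (ham m x) = 0,
      op_le (- (a * (volume d L)%:R)%:C)%:M (charge m)
    & op_le (charge m) ((a * (volume d L)%:R)%:C)%:M].

Definition A2 :=
  [/\ forall x, local1 m x \is hermsymmx /\ local2 m x \is hermsymmx,
      exists U : site d L -> 'M[R[i]]_n,
        [/\ forall x, U x \is unitarymx,
            copies_under U (local1 m) & copies_under U (local2 m)],
      comm Ord1 (charge m) = - 'i *: Ord2,
      comm Ord2 (charge m) = 'i *: Ord1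
    & comm Ord1 Ord2 = 'i *: charge m].

Definition A3 (zeta : nat) (h0 o0 : R) :=
  [/\ forall x, exists S : {set site d L},
        [/\ x \in S, (#|S| <= zeta)%N & acts_on S (ham m x)],
      forall x, acts_on [set x] (local1 m x) /\ acts_on [set x] (local2 m x),
      forall x, opnorm (ham m x) = h0
    & forall x, opnorm (local1 m x + 'i *: local2 m x) = o0 /\
                opnorm (local1 m x - 'i *: local2 m x) = o0].

Definition A4 :=
  unique_ground_state Ham (gsE m) (gs m) /\
  charge m *m gs m = (gsM m)%:C *: gs m.

Definition A5 (q0 : R) :=
  expval (gs m) (((volume d L)%:R^-1 *: Ord1) ^+ 2) =
    expval (gs m) (((volume d L)%:R^-1 *: Ord2) ^+ 2) /\
  q0%:C <= expval (gs m) (((volume d L)%:R^-1 *: Ord1) ^+ 2).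

Definition assumptions (a : R) (zeta : nat) (h0 o0 q0 : R) :=
  hamiltonian_setting /\ [/\ A1 a, A2, A3 zeta h0 o0, A4 & A5 q0].

Definition tower_num (M : int) : state R d n L :=
  (if 0 <= M then OrdP ^+ `|M|%N else OrdM ^+ `|M|%N) *m gs m.

Definition tower (M : int) : state R d n L :=
  ((ketnorm (tower_num M))^-1)%:C *: tower_num M.

End Lattice.

(* Main.v *)
Require Import Defs.
From mathcomp Require Import all_boot all_order all_algebra.
From mathcomp Require Import classical_sets reals complex.
From mathcomp Require Import zify ring lra.

Set Implicit Arguments.
Unset Strict Implicit.
Unset Printing Implicit Defensive.
Import Order.TTheory GRing.Theory Num.Theory.
Local Open Scope ring_scope.
Local Open Scope sesquilinear_scope.
Local Open Scope complex_scope.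

(** Normalize the energy so that the ground state [phi] has energy [0], and let
    [P], [Q] be the ladder operators.  Since [[P, Q] = 2 C] is small compared with the
    long-range order [tau = q0 V^2], Cauchy-Schwarz gives [|P^(k+1) phi|^2 >= tau |P^k phi|^2]
    for [k] up to [C1 sqrt V], and reordering shows that every word of length [p] in [P]
    and [Q] maps [phi] to a vector of squared norm at most [2 |P^p phi|^2].  The energies of
    [P^K phi] and [Q^K phi] are nonnegative and add up to the modulus of the expectation of
    the double commutator [[Q^K, [P^K, H]]].  It expands into [K^2] terms in which either
    both letters are absorbed by [H], at the cost of a local operator of norm [O(V)] in
    place of two letters, or one pair [P], [Q] is replaced by a charge.  Commuting [P] or [Q]
    through a sum of [V] local operators again gives such a sum, of norm larger by a factor
    independent of [V]; hence letters can be moved across it to balance the two sides. *)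

Notation cabs := ComplexField.Normc.normc.

(** * Inner product, norm and operator norm in finite dimension *)

Section HilbertSpace.
Variables (R : realType) (N : nat).
Implicit Types (A B : 'M[R[i]]_N) (u v w : 'cV[R[i]]_N) (z : R[i]).

Lemma cabsE z : `|z| = (cabs z)%:C.
Proof. by []. Qed.

Lemma cabs_ge0 z : 0 <= cabs z.
Proof. by rewrite -lecR -cabsE normr_ge0. Qed.

Lemma cabsM z1 z2 : cabs (z1 * z2) = cabs z1 * cabs z2.
Proof. exact: ComplexField.Normc.normcM. Qed.

Lemma cabsD z1 z2 : cabs (z1 + z2) <= cabs z1 + cabs z2.
Proof. exact: le_normcD. Qed.

Lemma cabsB z1 z2 : cabs (z1 - z2) <= cabs z1 + cabs z2.
Proof. by rewrite -[cabs z2](normcN z2); exact: le_normcD. Qed.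

Lemma cabs_sum I (r : seq I) (P : pred I) (F : I -> R[i]) :
  cabs (\sum_(i <- r | P i) F i) <= \sum_(i <- r | P i) cabs (F i).
Proof.
elim/big_rec2: _ => [|i y x _ le_xy]; first by rewrite ComplexField.Normc.normc0.
by apply: le_trans (cabsD _ _) _; rewrite lerD2l.
Qed.

Lemma cabsC (x : R) : cabs x%:C = `|x|.
Proof. by rewrite /= expr0n addr0 sqrtr_sqr. Qed.

Lemma braketE u v : braket u v = \sum_i (u i 0)^* * v i 0.
Proof. by rewrite /braket mxE; apply: eq_bigr => i _; rewrite !mxE. Qed.

Lemma braket0r u : braket u 0 = 0.
Proof. by rewrite /braket mulmx0 mxE. Qed.

Lemma braketDr u v w : braket u (v + w) = braket u v + braket u w.
Proof. by rewrite /braket mulmxDr mxE. Qed.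

Lemma braketBr u v w : braket u (v - w) = braket u v - braket u w.
Proof. by rewrite /braket mulmxBr !mxE. Qed.

Lemma braketZr z u v : braket u (z *: v) = z * braket u v.
Proof. by rewrite /braket -scalemxAr mxE. Qed.

Lemma braket_conj u v : braket v u = (braket u v)^*.
Proof.
rewrite !braketE rmorph_sum; apply: eq_bigr => i _ /=.
by rewrite rmorphM /= mulrC; congr (_ * _); exact/esym/conjCK.
Qed.

Lemma braket0l u : braket 0 u = 0.
Proof. by rewrite braket_conj braket0r rmorph0. Qed.

Lemma braketDl u v w : braket (u + v) w = braket u w + braket v w.
Proof. by rewrite braket_conj braketDr rmorphD /= -!braket_conj. Qed.

Lemma braketZl z u v : braket (z *: u) v = z^* * braket u v.
Proof. by rewrite braket_conj braketZr rmorphM /= -braket_conj. Qed.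

Lemma braket_adj A u v : braket u (A *m v) = braket (A^t* *m u) v.
Proof.
by rewrite /braket trmx_mul map_mxM trmxCK mulmxA.
Qed.

Lemma braket_ge0 v : 0 <= braket v v.
Proof.
rewrite braketE sumr_ge0 // => i _.
by rewrite mulrC -normCK exprn_ge0.
Qed.

Lemma ketnorm_ge0 v : 0 <= ketnorm v.
Proof. exact: sqrtr_ge0. Qed.

Lemma sqr_ketnorm v : (ketnorm v ^+ 2)%:C = braket v v.
Proof.
have := braket_ge0 v; rewrite /ketnorm lecE /= => /andP[/eqP im0 re0].
by rewrite sqr_sqrtr //; case: (braket v v) im0 => a b /= ->.
Qed.

Lemma cabs_braket v : cabs (braket v v) = ketnorm v ^+ 2.
Proof.
by rewrite -sqr_ketnorm cabsC ger0_norm // exprn_ge0 // ketnorm_ge0.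
Qed.

Lemma cauchy_schwarz u v : cabs (braket u v) <= ketnorm u * ketnorm v.
Proof.
have : `|dotmx v^T u^T| <= sqrtC (dotmx v^T v^T) * sqrtC (dotmx u^T u^T).
  by have [] := @CauchySchwarz_sqrt _ _ (@dotmx R[i] N) v^T u^T.
have dotE (x y : 'cV[R[i]]_N) : dotmx x^T y^T = braket y x.
  rewrite dotmxE mxE braketE; apply: eq_bigr => i _.
  by rewrite !mxE mulrC.
rewrite !dotE -!sqr_ketnorm !rmorphXn /=.
by rewrite !sqrCK ?ler0c ?ketnorm_ge0 // -rmorphM cabsE lecR mulrC.
Qed.

Lemma ketnormZ z v : ketnorm (z *: v) = cabs z * ketnorm v.
Proof.
apply: (@pexpIrn _ 2) => //; rewrite ?nnegrE ?mulr_ge0 ?ketnorm_ge0 ?cabs_ge0 //.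
apply: complexI; rewrite sqr_ketnorm braketZr braketZl mulrA -normCK.
by rewrite exprMn rmorphM /= sqr_ketnorm cabsE rmorphXn.
Qed.

Lemma ketnormN v : ketnorm (- v) = ketnorm v.
Proof. by rewrite -scaleN1r ketnormZ normcN ComplexField.Normc.normc1 mul1r. Qed.

Lemma ketnormD u v : ketnorm (u + v) <= ketnorm u + ketnorm v.
Proof.
rewrite -(@ler_pXn2r _ 2) ?nnegrE ?addr_ge0 ?ketnorm_ge0 //.
rewrite -cabs_braket braketDl !braketDr.
have := cabsD (braket u u + braket u v) (braket v u + braket v v).
have := cabsD (braket u u) (braket u v); have := cabsD (braket v u) (braket v v).
have := cauchy_schwarz u u; have := cauchy_schwarz v v.
have := cauchy_schwarz u v; have := cauchy_schwarz v u.
move: (cabs _) (cabs _) (cabs _) (cabs _) (cabs _) (cabs _) (cabs _).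
by move=> c1 c2 c3 c4 c5 c6 c7; rewrite sqrrD; lra.
Qed.

Lemma ketnormB u v : ketnorm (u - v) <= ketnorm u + ketnorm v.
Proof. by rewrite -[ketnorm v]ketnormN ketnormD. Qed.

Lemma ketnorm0 : ketnorm (0 : 'cV[R[i]]_N) = 0.
Proof. by rewrite -(scale0r 0) ketnormZ ComplexField.Normc.normc0 mul0r. Qed.

Lemma ketnorm_sum I (r : seq I) (P : pred I) (F : I -> 'cV[R[i]]_N) :
  ketnorm (\sum_(i <- r | P i) F i) <= \sum_(i <- r | P i) ketnorm (F i).
Proof.
elim/big_rec2: _ => [|i y x _ le_xy]; first by rewrite ketnorm0.
by apply: le_trans (ketnormD _ _) _; rewrite lerD2l.
Qed.

Lemma ketnorm_eq0 v : ketnorm v = 0 -> v = 0.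
Proof.
move=> v0; have := sqr_ketnorm v; rewrite v0 expr0n /= braketE => /esym/eqP.
rewrite psumr_eq0 => [/allP h|i _]; last by rewrite mulrC -normCK exprn_ge0.
apply/matrixP => i j; rewrite ord1 mxE.
have := h i (mem_index_enum _); rewrite mulrC -normCK expf_eq0 /=.
by rewrite normr_eq0 => /eqP.
Qed.

Lemma ketnorm_delta_le v i : cabs (v i 0) <= ketnorm v.
Proof.
rewrite -(@ler_pXn2r _ 2) ?nnegrE ?ketnorm_ge0 ?cabs_ge0 //.
rewrite -lecR sqr_ketnorm rmorphXn /= -cabsE normCK braketE (bigD1 i) //= mulrC lerDl.
by rewrite sumr_ge0 // => j _; rewrite mulrC -normCK exprn_ge0.
Qed.

(** A crude estimate by columns: it makes the set in [opnorm] bounded above, so that its supremum is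
    a genuine upper bound. *)
Lemma mulmx_bounded A : exists K : R, forall v, ketnorm (A *m v) <= K * ketnorm v.
Proof.
exists (\sum_j ketnorm (col j A)) => v.
have -> : A *m v = \sum_j v j 0 *: col j A.
  apply/matrixP => i k; rewrite ord1 mxE summxE.
  by apply: eq_bigr => j _; rewrite !mxE mulrC.
apply: le_trans (ketnorm_sum _ _ _) _; rewrite mulr_suml ler_sum // => j _.
by rewrite ketnormZ mulrC ler_wpM2l ?ketnorm_ge0 ?ketnorm_delta_le.
Qed.

Lemma opnormP A v : ketnorm (A *m v) <= opnorm A * ketnorm v.
Proof.
have [v0|v0] := eqVneq (ketnorm v) 0.
  by rewrite v0 mulr0 (ketnorm_eq0 v0) mulmx0 ketnorm0.
have vpos : 0 < ketnorm v by rewrite lt_def v0 ketnorm_ge0.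
have vE : v = (ketnorm v)%:C *: ((ketnorm v)^-1%:C *: v).
  by rewrite scalerA -rmorphM mulfV // scale1r.
rewrite {1}vE -scalemxAr ketnormZ cabsC gtr0_norm // mulrC ler_pM2r //.
apply: ub_le_sup; last first.
  exists ((ketnorm v)^-1%:C *: v); split => //.
  by rewrite ketnormZ cabsC ger0_norm ?invr_ge0 ?ketnorm_ge0 // mulVf.
have [K hK] := mulmx_bounded A.
by exists K => _ [u [u1 ->]]; rewrite (le_trans (hK u)) // u1 mulr1.
Qed.

Lemma hermsymmx_adj A : A \is hermsymmx -> A^t* = A.
Proof. by move=> /is_hermitianmxP; rewrite expr0 scale1r. Qed.

(** By the spectral theorem the rows of the unitary [P] are row eigenvectors of [A], so every entry
    of [D] is an eigenvalue and hence at least [E]. In this basis the form is the sum of the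
    [(D_i - E) |(P v)_i|^2]. *)
Lemma lowest_eigenvalue_le A E v : A \is hermsymmx -> lowest_eigenvalue A E ->
  0 <= braket v ((A - E%:C%:M) *m v).
Proof.
move=> Ah [_ Emin]; have /hermitian_normalmx/orthomx_spectralP := Ah.
set P := spectralmx A; set D := spectral_diag A => AE.
have Pu : P \is unitarymx by exact: spectral_unitarymx.
have Pinv : invmx P = P^t* by exact: invmx_unitary.
have PPt : P^t* *m P = 1%:M by rewrite -Pinv mulVmx // spectral_unit.
have D_ge i : (E%:C <= D 0 i).
  have /mxOverP/(_ 0 i)/complex_realP[d dE] := hermitian_spectral_diag_real Ah.
  rewrite -/D in dE; rewrite dE lecR; apply: Emin; apply/eigenvalueP.
  exists (row i P); last first.
    apply/eqP => r0; have := mul1mx (row i P).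
    have /unitarymxP/(congr1 (row i)) := Pu.
    rewrite row_mul r0 mul0mx row1 => /matrixP/(_ 0 i) /=.
    by rewrite !mxE !eqxx => /eqP; rewrite eq_sym oner_eq0.
  rewrite {1}AE -row_mul !mulmxA mulmxV ?spectral_unit // mul1mx row_mul.
  rewrite -dE -/P; apply/matrixP => a b; rewrite !mxE.
  rewrite (bigD1 i) //= !mxE eqxx mulr1n big1 ?addr0 // => j ji.
  by rewrite !mxE eq_sym (negPf ji) mulr0n mul0r.
have -> : A - E%:C%:M = P^t* *m (diag_mx D - E%:C%:M) *m P.
  by rewrite mulmxBr mulmxBl -Pinv -AE Pinv mul_mx_scalar -scalemxAl PPt scalemx1.
rewrite -!mulmxA braket_adj trmxCK braketE sumr_ge0 // => i _.
have -> : ((diag_mx D - E%:C%:M) *m (P *m v)) i 0 =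
          (D 0 i - E%:C) * (P *m v) i 0.
  rewrite mulmxBl mul_scalar_mx mul_diag_mx !mxE mulrBl; congr (_ * _ - _).
by rewrite mulrCA mulr_ge0 ?subr_ge0 // mulrC -normCK exprn_ge0.
Qed.

End HilbertSpace.

(* [sval (seal f)] keeps the unifier from comparing the bodies of [f x] and [f y],
   which is prohibitively slow for expressions in matrices. *)
Lemma seal (T : Type) (x : T) : {y | y = x}.
Proof. by exists x. Qed.

(** * Commutator identities and scalar estimates *)

Lemma commutator_exp (T : pzRingType) (X Y : T) n :
  Y ^+ n * X - X * Y ^+ n =
  \sum_(k < n) Y ^+ k * (Y * X - X * Y) * Y ^+ (n.-1 - k).
Proof.
elim: n => [|n IH]; first by rewrite big_ord0 mul1r mulr1 subrr.
rewrite big_ord_recr /= subnn expr0 mulr1.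
have -> : Y ^+ n.+1 * X - X * Y ^+ n.+1 =
    (Y ^+ n * X - X * Y ^+ n) * Y + Y ^+ n * (Y * X - X * Y).
  by rewrite !mulrBl !mulrBr !exprSr !mulrA [RHS]addrC addrA subrK.
rewrite IH mulr_suml; congr (_ + _); apply: eq_bigr => k _.
by rewrite -mulrA -exprSr; case: n k {IH} => [[]|n] // k; rewrite subSn // -ltnS.
Qed.

(** Leibniz' rule for [[q, x d y]]. The outer commutators are written as [x q - q x] and
    [y q - q y], the form that [commutator_exp] expands when [x] and [y] are powers. *)
Lemma commutator_sandwich (T : pzRingType) (q x d y : T) :
  q * (x * d * y) - x * d * y * q =
  x * (q * d - d * q) * y - (x * q - q * x) * d * y - x * d * (y * q - q * y).
Proof.
rewrite !mulrBr !mulrBl !mulrA !opprB.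
have cancel (a b c : T) : a - b + (c - a) = c - b by rewrite addrC addrA subrK.
by rewrite cancel addrA subrK.
Qed.

(** The induction rests on [(1 + t) (1 - (n + 1) t) <= 1 - n t]. Once [n t <= 1/2], the conclusion
    gives [(1 + t)^n <= 2]. *)
Lemma bernoulli_inv (F : realFieldType) (t : F) n : 0 <= t ->
  (1 + t) ^+ n * (1 - n%:R * t) <= 1.
Proof.
move=> t0; elim: n => [|n IH]; first by rewrite expr0 mul0r subr0 mulr1.
apply: le_trans IH; rewrite exprSr -mulrA ler_wpM2l ?exprn_ge0 ?addr_ge0 //.
by have := ler0n F n; rewrite -natr1; nra.
Qed.

Lemma ratio_arith (F : realFieldType) (t n1 mu k K : F) : 0 <= k -> k <= K ->
  2 * t - `|mu| <= n1 -> (2 * K + 1) * `|mu| + K * (K + 1) <= t ->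
  t <= n1 - 2 * k * mu - k * (k + 1).
Proof.
move=> k0 kK hn1 ht.
have h1 : k * mu <= K * `|mu|.
  by rewrite (le_trans (ler_wpM2l k0 (ler_norm mu))) // ler_wpM2r.
have h2 : k * (k + 1) <= K * (K + 1) by rewrite ler_pM ?lerD2r // addr_ge0.
have -> : n1 - 2 * k * mu - k * (k + 1) = n1 - 2 * (k * mu) - k * (k + 1) by ring.
have {}ht : 2 * (K * `|mu|) + `|mu| + K * (K + 1) <= t.
  by rewrite mulrA -[X in _ + X + _]mul1r -mulrDl.
move: h1 h2 hn1 ht.
by move: (K * `|mu|) (k * mu) (k * (k + 1)) (K * (K + 1)) => *; lra.
Qed.

(** The left side is the cost of sorting a word of length [2 (p + 1)], in units of the squared norm
    of [P^p phi]: at most [(2 (p + 1))^2] swaps, each a charge factor [2 (m + 2 p)] times the factor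
    [2] of the word bound. *)
Lemma swap_arith (F : realFieldType) (m K : F) (p : nat) : 0 <= m -> p.+1%:R <= K ->
  (p.+1%:R * 2) ^+ 2 * 2 * (m + p%:R * 2) * 2 <= 16 * K ^+ 2 * (m + 2 * K).
Proof.
have p0 := ler0n F p; rewrite -natr1; move: (p%:R) p0 => q q0 m0 qK.
have h1 : (q + 1) ^+ 2 <= K ^+ 2 by rewrite ler_pXn2r ?nnegrE //; lra.
have h2 : m + q * 2 <= m + 2 * K by lra.
have -> : ((q + 1) * 2) ^+ 2 * 2 * (m + q * 2) * 2 = 16 * ((q + 1) ^+ 2 * (m + q * 2)).
  by ring.
rewrite -mulrA ler_pM2l // ler_pM ?sqr_ge0 //; lra.
Qed.

Lemma ratio_succ (F : realFieldType) (n1 mu : F) (k : nat) :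
  n1 - 2 * k.+1%:R * mu - k.+1%:R * (k.+1%:R + 1) =
  n1 - 2 * k%:R * mu - k%:R * (k%:R + 1) - 2 * (mu + k.+1%:R).
Proof. by rewrite -natr1; ring. Qed.

(** * The tower of states over an abstract pair of ladder operators *)

Section Tower.
Variables (R : realType) (N : nat) (P Q C H : 'M[R[i]]_N) (phi : 'cV[R[i]]_N).
(** [loc b B] abstracts that [B] is a sum of local operators of total norm at most [b]; [g] is the
    factor lost when commuting with [P] or [Q]. The order [q0 V^2] is abstracted as [tau], and [K]
    is the height of the state in the tower. *)
Variables (mu g b0 tau : R) (loc : R -> 'M[R[i]]_N -> Prop) (K : nat).
Hypotheses (adjP : P^t* = Q) (commPQ : P * Q - Q * P = C *+ 2)
  (CP : C * P = P * C + P) (CQ : C * Q = Q * C - Q) (CH : C * H = H * C).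
Hypotheses (Cphi : C *m phi = mu%:C *: phi) (Hphi : H *m phi = 0)
  (adjH : H^t* = H)
  (phi1 : ketnorm phi = 1).
Hypotheses (g_ge0 : 0 <= g) (b0_ge0 : 0 <= b0)
  (loc_bound : forall b B v, loc b B -> ketnorm (B *m v) <= b * ketnorm v)
  (locP : forall b B, loc b B -> loc (g * b) (P * B - B * P))
  (locQ : forall b B, loc b B -> loc (g * b) (Q * B - B * Q))
  (locH : loc (g * b0) (P * H - H * P)).

Let adjQ : Q^t* = P. Proof. by rewrite -adjP trmxCK. Qed.

Definition mean : 'M[R[i]]_N -> R[i] := sval (seal (expval phi)).
Definition norm2 : nat -> R :=
  sval (seal (fun k => ketnorm (P ^+ k *m phi) ^+ 2)).

Let norm2E k : ketnorm (P ^+ k *m phi) ^+ 2 = norm2 k.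
Proof. by rewrite /norm2 (svalP (seal _)). Qed.

Let exE A : mean A = braket phi (A *m phi).
Proof. by rewrite /mean (svalP (seal _)). Qed.

Let exD A B : mean (A + B) = mean A + mean B.
Proof. by rewrite !exE mulmxDl braketDr. Qed.

Let exB A B : mean (A - B) = mean A - mean B.
Proof. by rewrite !exE mulmxBl braketBr. Qed.

Let exZ z A : mean (z *: A) = z * mean A.
Proof. by rewrite !exE -scalemxAl braketZr. Qed.

Let ex_sum n (F : 'I_n -> 'M[R[i]]_N) : mean (\sum_i F i) = \sum_i mean (F i).
Proof.
elim/big_rec2: _ => [|i y x _ <-]; last by rewrite exD.
by rewrite !exE mul0mx braket0r.
Qed.

(** [A] is an eigenvector of [[C, .]], so it shifts the charge by a fixed [k]; only the bound [n] on
    the shift is recorded. *)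
Definition charge_le (A : 'M[R[i]]_N) (n : nat) :=
  exists2 k : R, `|k| <= n%:R & C * A = A * C + k%:C *: A.

Let scaleAl z (A B : 'M[R[i]]_N) : z *: (A * B) = (z *: A) * B.
Proof. exact: scalemxAl. Qed.

Let scaleAr z (A B : 'M[R[i]]_N) : z *: (A * B) = A * (z *: B).
Proof. exact: scalemxAr. Qed.

Lemma charge_leM A B m n :
  charge_le A m -> charge_le B n -> charge_le (A * B) (m + n).
Proof.
move=> [k km hA] [l ln hB]; exists (k + l).
  by rewrite natrD (le_trans (ler_normD _ _)) // lerD.
rewrite mulrA hA mulrDl -mulrA hB mulrDr mulrA -addrA; congr (_ + _).
by rewrite rmorphD scalerDl [RHS]addrC scaleAr scaleAl.
Qed.

Lemma charge_leP : charge_le P 1.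
Proof. exists 1; first by rewrite normr1.
by rewrite CP scale1r. Qed.

Lemma charge_leQ : charge_le Q 1.
Proof. exists (-1); first by rewrite normrN1.
by rewrite CQ rmorphN scaleNr scale1r. Qed.

(** As [C] commutes with [H], the commutator [[P, H]] carries the same charge as [P]. *)
Lemma charge_leD : charge_le (P * H - H * P) 1.
Proof.
exists 1; first by rewrite normr1.
rewrite scale1r mulrBr mulrBl !mulrA CP CH mulrDl -!mulrA.
rewrite CP CH mulrDr !mulrA opprD !addrA; congr (_ - _).
by rewrite -!addrA; congr (_ + _); rewrite addrC.
Qed.

(** [B phi] is an eigenvector of [C] for [mu + k], so the inner [[P, Q] = 2 C] acts on it as the
    number [2 (mu + k)]. *)
Lemma ex_charge A B n : charge_le B n ->
  cabs (mean (A * (P * Q - Q * P) * B)) <= 2 * (`|mu| + n%:R) * cabs (mean (A * B)).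
Proof.
move=> [k kn hB]; rewrite commPQ.
have -> : mean (A * (C *+ 2) * B) = (2 * (mu + k))%:C * mean (A * B).
  rewrite -exZ !exE; congr (braket _ _).
  rewrite mulrnAr mulrnAl -mulrA hB -scaler_nat -scalemxAl.
  rewrite rmorphM rmorph_nat -[RHS]scalemxAl -scalerA; congr (_ *: _).
  rewrite mulrDr mulmxDl -scaleAr rmorphD scalerDl -scalemxAl; congr (_ + _).
  by rewrite mulrA -[_ *m phi]mulmxA Cphi -scalemxAr.
rewrite cabsM cabsC ler_wpM2r ?cabs_ge0 // normrM ger0_norm //.
by rewrite ler_wpM2l // (le_trans (ler_normD _ _)) // lerD2l.
Qed.

(** * Words in the ladder operators *)

Definition letter (c : bool) : 'M[R[i]]_N := if c then P else Q.
Definition wop (w : seq bool) : 'M[R[i]]_N := \prod_(c <- w) letter c.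
Let adjw (w : seq bool) := rev (map negb w).

Let wop_cat u v : wop (u ++ v) = wop u * wop v.
Proof. by rewrite /wop big_cat. Qed.

Let wop_cons c u : wop (c :: u) = letter c * wop u.
Proof. by rewrite /wop big_cons. Qed.

Let wop_nil : wop [::] = 1.
Proof. by rewrite /wop big_nil. Qed.

Let wop_nseq n c : wop (nseq n c) = letter c ^+ n.
Proof. by elim: n => [|n IH]; rewrite ?wop_nil // wop_cons IH exprS. Qed.

Let wop_adj w : (wop w)^t* = wop (adjw w).
Proof.
elim: w => [|c w IH]; first by rewrite !wop_nil /= trmx1 map_mx1.
rewrite /adjw /= rev_cons -cats1 wop_cat !wop_cons wop_nil mulr1 -[rev _]/(adjw w).
rewrite -IH trmx_mul map_mxM; congr (_ * _).
by case: c; rewrite /= ?adjP ?adjQ.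
Qed.

Let size_adjw w : size (adjw w) = size w.
Proof. by rewrite size_rev size_map. Qed.

Let adjwK w : adjw (adjw w) = w.
Proof.
rewrite /adjw map_rev revK -map_comp -[RHS]map_id.
by apply: eq_map => c /=; rewrite negbK.
Qed.

Lemma charge_le_word w : charge_le (wop w) (size w).
Proof.
elim: w => [|c w IH].
  by exists 0; rewrite ?normr0 // wop_nil mulr1 mul1r scale0r addr0.
rewrite wop_cons /= -add1n; apply: charge_leM IH.
by case: c; [exact: charge_leP | exact: charge_leQ].
Qed.

Let ex_word_split u v :
  cabs (mean (wop u * wop v)) <= ketnorm (wop (adjw u) *m phi) * ketnorm (wop v *m phi).
Proof.
rewrite !exE -mulmxA braket_adj wop_adj; exact: cauchy_schwarz.
Qed.

Let ex_word_sqr w :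
  ketnorm (wop w *m phi) ^+ 2 = cabs (mean (wop (adjw w ++ w))).
Proof.
by rewrite wop_cat !exE -mulmxA braket_adj wop_adj adjwK cabs_braket.
Qed.

(** * Sorting the letters of a word inside an expectation *)

Section Reorder.
Variables (p : nat) (D : R).
Hypothesis word_le : forall w, size w = p.*2 -> cabs (mean (wop w)) <= D.
(** The price of exchanging adjacent letters [P Q] in a word of length [2 p + 2]: the commutator is
    a charge, and a word of length [2 p] is left. *)
Let swap_cost := 2 * (`|mu| + p.*2%:R) * D.

Let swap_ge0 : 0 <= swap_cost.
Proof.
have D0 : 0 <= D.
  by apply: le_trans (word_le (w := nseq p.*2 true) _); rewrite ?cabs_ge0 ?size_nseq.
by rewrite !mulr_ge0 // addr_ge0.
Qed.

Lemma move_letter x j y : (size x + j + size y = p.*2.+1)%N ->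
  cabs (mean (wop (x ++ true :: nseq j false ++ y)) -
        mean (wop (x ++ nseq j false ++ true :: y))) <= j%:R * swap_cost.
Proof.
elim: j x => [|j IH] x sz; first by rewrite subrr mul0r ComplexField.Normc.normc0.
have := IH (rcons x false); rewrite size_rcons !cat_rcons => /(_ _) IH'.
set A := mean _; set B := mean (wop (x ++ nseq j.+1 _ ++ _)).
set E := mean (wop (x ++ false :: true :: nseq j false ++ y)).
have -> : A - B = (A - E) + (E - B) by rewrite addrA subrK.
apply: le_trans (cabsD _ _) _; rewrite -natr1 mulrDl mul1r addrC lerD //.
  by apply: IH'; lia.
rewrite -exB /= !wop_cat !wop_cons -mulrBr !mulrA -!mulrBl.
have := ex_charge (wop x) (charge_le_word (nseq j false ++ y)).
rewrite /= wop_cat !mulrA => /le_trans; apply.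
have le1 : (size (nseq j false ++ y))%:R <= p.*2%:R :> R.
  by rewrite ler_nat size_cat size_nseq; lia.
have le2 := word_le (w := x ++ nseq j false ++ y) _.
rewrite !wop_cat mulrA in le2.
apply: ler_pM; rewrite ?mulr_ge0 ?addr_ge0 ?cabs_ge0 //.
  by rewrite ler_wpM2l // lerD2l.
by apply: le2; rewrite !size_cat size_nseq; lia.
Qed.

(** Insertion sort: the tail is sorted first, then its head stays in place if it is [Q], and is
    carried by [move_letter] through all the [Q] if it is [P]. *)
Lemma sort_word x w : (size x + size w = p.*2.+2)%N ->
  cabs (mean (wop (x ++ w)) -
    mean (wop (x ++ nseq (count negb w) false ++ nseq (count id w) true)))
  <= (size w)%:R ^+ 2 * swap_cost.
Proof.
elim: w x => [|c w IH] x sz.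
  by rewrite subrr ComplexField.Normc.normc0 mulr_ge0 // sqr_ge0.
have {IH} := IH (rcons x c); rewrite size_rcons !cat_rcons => /(_ _) IH.
have szE : (size w)%:R ^+ 2 * swap_cost + (size w)%:R * swap_cost
    <= (size (c :: w))%:R ^+ 2 * swap_cost.
  rewrite -mulrDl ler_wpM2r // /= -natr1.
  by have := ler0n R (size w); nra.
have {}IH := IH ltac:(by move: sz => /=; lia).
apply: le_trans szE; case: c IH sz => /= IH sz; last first.
  by rewrite !add0n; apply: le_trans IH _; rewrite lerDl mulr_ge0.
rewrite !add0n.
set A := mean _; set B := mean (wop (x ++ nseq _ _ ++ true :: _)).
set E := mean (wop (x ++ true :: nseq (count negb w) false ++ nseq (count id w) true)).
have -> : A - B = (A - E) + (E - B) by rewrite addrA subrK.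
apply: le_trans (cabsD _ _) _; apply: lerD => //.
apply: le_trans (move_letter _) _.
  by rewrite size_nseq; have := count_predC id w; rewrite -[count (predC id) w]/(count negb w); lia.
by rewrite ler_wpM2r // ler_nat count_size.
Qed.

End Reorder.

Let P_exp_word k : P ^+ k = wop (nseq k true).
Proof. by rewrite wop_nseq. Qed.

Let Q_exp_word k : Q ^+ k = wop (nseq k false).
Proof. by rewrite wop_nseq. Qed.

Let adjw_true k : adjw (nseq k true) = nseq k false.
Proof. by rewrite /adjw map_nseq rev_nseq. Qed.

Let exp_succ k : P ^+ k.+1 *m phi = P *m (P ^+ k *m phi).
Proof. by rewrite exprS -mulmxA. Qed.

Let norm2_ge0 k : 0 <= norm2 k.
Proof. by rewrite -norm2E exprn_ge0 // ketnorm_ge0. Qed.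

Lemma charge_expP k : C *m (P ^+ k *m phi) = (mu + k%:R)%:C *: (P ^+ k *m phi).
Proof.
elim: k => [|k IH]; first by rewrite expr0 mul1mx addr0.
rewrite exp_succ; set v := P ^+ k *m phi in IH *.
rewrite mulmxA [C *m P]CP mulmxDl -mulmxA IH -scalemxAr -natr1 addrA.
by rewrite [in RHS]rmorphD rmorph1 [in RHS]scalerDl scale1r.
Qed.

(** Cauchy-Schwarz on [|v|^2 = <u, Q v>] gives [|Q v|^2 >= r |v|^2], and [[P, Q] = 2 C] gives
    [|P v|^2 = |Q v|^2 - 2 c |v|^2]. *)
Lemma ladder_step (u v : 'cV[R[i]]_N) (c r nu nv nw : R) : v = P *m u ->
  C *m v = c%:C *: v -> ketnorm u ^+ 2 = nu -> ketnorm v ^+ 2 = nv ->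
  ketnorm (P *m v) ^+ 2 = nw -> 0 < nu -> r * nu <= nv -> (r - 2 * c) * nv <= nw.
Proof.
move=> vE Cv <- <- <- u0 ruv.
have -> : ketnorm (P *m v) ^+ 2 = ketnorm (Q *m v) ^+ 2 - 2 * c * ketnorm v ^+ 2.
  apply: complexI; rewrite sqr_ketnorm -{1}adjQ -braket_adj mulmxA.
  have -> : Q *m P = P *m Q - C *+ 2 by rewrite -commPQ opprB addrC subrK.
  rewrite mulmxBl braketBr -mulmxA braket_adj adjP -sqr_ketnorm rmorphB.
  congr (_ - _); rewrite -scaler_nat -scalemxAl Cv !braketZr -sqr_ketnorm mulrA.
  by rewrite -(rmorph_nat (real_complex R)) -!rmorphM.
rewrite mulrBl lerD2r.
have : ketnorm v ^+ 2 <= ketnorm u * ketnorm (Q *m v).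
  by rewrite -cabs_braket {1}vE -{1}adjQ -braket_adj; exact: cauchy_schwarz.
have := ketnorm_ge0 v; move: (ketnorm (Q *m v)) (ketnorm v) (ketnorm u) u0 ruv.
move=> q w x x0 xw w0 wq; rewrite -(ler_pM2l x0).
rewrite mulrA [x ^+ 2 * r]mulrC -exprMn (le_trans (ler_wpM2r (sqr_ge0 w) xw)) //.
by rewrite -expr2 ler_pXn2r ?nnegrE ?sqr_ge0 // (le_trans (sqr_ge0 w)).
Qed.

Hypothesis tau_gt0 : 0 < tau.

(** * Growth of the norms along the tower *)

Section Growth.
Hypotheses (norm2_1 : 2 * tau - `|mu| <= norm2 1)
  (tau_mu : (2 * K%:R + 1) * `|mu| + K%:R * (K%:R + 1) <= tau).

(** Closed form of the recursion that [ladder_step] imposes on lower bounds for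
    [norm2 k.+1 / norm2 k]: each step subtracts twice the charge [mu + k + 1]. *)
Definition ratio : nat -> R :=
  sval (seal (fun k => norm2 1 - 2 * k%:R * mu - k%:R * (k%:R + 1))).

Let ratioE k : ratio k = norm2 1 - 2 * k%:R * mu - k%:R * (k%:R + 1).
Proof. by rewrite /ratio (svalP (seal _)). Qed.

Let ratio_ge k : (k <= K)%N -> tau <= ratio k.
Proof.
rewrite ratioE => kK; apply: (ratio_arith (ler0n _ _) _ norm2_1 tau_mu).
by rewrite ler_nat.
Qed.

Let ratio0 : ratio 0 = norm2 1.
Proof. by rewrite ratioE mulr0 !mul0r !subr0. Qed.

Let ratioS k : ratio k.+1 = ratio k - 2 * (mu + k.+1%:R).
Proof. by rewrite !ratioE ratio_succ. Qed.

Lemma norm2_ratio k : (k < K)%N -> 0 < norm2 k /\ ratio k * norm2 k <= norm2 k.+1.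
Proof.
clear norm2_1 tau_mu.
elim: k => [|k IH] kK.
  have -> : norm2 0 = 1 by rewrite -norm2E expr0 mul1mx phi1 expr1n.
  by rewrite ratio0 mulr1; split; first exact: ltr01.
have {IH}[pos IH] := IH (ltnW kK).
have r_ge := ratio_ge (ltnW (ltnW kK)).
split; first by apply: lt_le_trans IH; apply: mulr_gt0 pos; apply: lt_le_trans r_ge.
rewrite ratioS; apply: (ladder_step (exp_succ k) (charge_expP k.+1)).
- exact: norm2E.
- exact: norm2E.
- by rewrite -exp_succ norm2E.
- exact: pos.
- exact: IH.
Qed.

Lemma norm2_growth k : (k < K)%N -> 0 < norm2 k /\ tau * norm2 k <= norm2 k.+1.
Proof.
move=> kK; have [pos h] := norm2_ratio kK; split; first exact: pos.
by apply: le_trans h; rewrite ler_pM2r; [apply/ratio_ge/ltnW | exact: pos].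
Qed.

End Growth.

(** * Norms of arbitrary words applied to the ground state *)

Section Energy.
Hypothesis growth : forall k, (k < K)%N -> tau * norm2 k <= norm2 k.+1.

(** Cutting the word in the middle and applying Cauchy-Schwarz leaves two words of length [p] acting
    on [phi]. *)
Let ex_word_half p w (D : R) : size w = p.*2 ->
  (forall v, size v = p -> ketnorm (wop v *m phi) ^+ 2 <= D) ->
  cabs (mean (wop w)) <= D.
Proof.
move=> sz hD; rewrite -(cat_take_drop p w) wop_cat.
apply: le_trans (ex_word_split _ _) _.
have h1 := hD (adjw (take p w)) _; have h2 := hD (drop p w) _.
have {}h1 := h1 ltac:(rewrite size_adjw size_takel //; lia).
have {}h2 := h2 ltac:(rewrite size_drop; lia).
have := sqr_ge0 (ketnorm (wop (adjw (take p w)) *m phi) - ketnorm (wop (drop p w) *m phi)).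
by move: (ketnorm _) (ketnorm _) h1 h2 => x y; nra.
Qed.

(* Reordering the letters of [W^* W] into [Q^p P^p] costs at most [4 p^2] swaps,
   each of which replaces a factor of size [tau] by a charge. *)
Lemma word_norm_sqr p w : 16 * K%:R ^+ 2 * (`|mu| + 2 * K%:R) <= tau ->
  (p <= K)%N -> size w = p -> ketnorm (wop w *m phi) ^+ 2 <= 2 * norm2 p.
Proof.
move=> tau_word; elim: p w => [|p IH] w pK sz.
  move/size0nil: sz => ->; rewrite wop_nil -norm2E expr0.
  by rewrite mulrDl mul1r lerDl exprn_ge0 // ketnorm_ge0.
have word_le v : size v = p.*2 -> cabs (mean (wop v)) <= 2 * norm2 p.
  by move=> szv; apply: ex_word_half szv _ => u szu; apply: IH => //; exact: ltnW.
have := @sort_word p _ word_le [::] (adjw w ++ w).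
rewrite !cat0s !size_cat size_adjw sz add0n => /(_ ltac:(lia)).
(* Passing to the adjoint exchanges the two letters, so [W^* W] contains each of them exactly
   [p + 1] times. *)
have cnt c : count (fun x => x == c) (adjw w ++ w) = p.+1.
  rewrite count_cat /adjw count_rev count_map -sz -(count_predC (fun x => x == c) w) addnC.
  by congr addn; apply: eq_count => -[]; case: c.
have -> : count id (adjw w ++ w) = p.+1 by rewrite -(cnt true); apply: eq_count => -[].
have -> : count negb (adjw w ++ w) = p.+1 by rewrite -(cnt false); apply: eq_count => -[].
have -> : norm2 p.+1 = cabs (mean (wop (nseq p.+1 false ++ nseq p.+1 true))).
  by rewrite -norm2E P_exp_word ex_word_sqr adjw_true.
rewrite ex_word_sqr; set A := mean _; set B := mean _ => AB.
have : cabs A <= cabs (A - B) + cabs B by rewrite -{1}(subrK B A) cabsD.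
move=> /le_trans; apply; rewrite mulrDl mul1r lerD2r.
(* What remains is the sorting error; [tau_word] and one step of growth bound it by another
   [norm2 p.+1], whence the factor [2]. *)
apply: le_trans AB _.
have -> : cabs B = norm2 p.+1 by rewrite -norm2E P_exp_word ex_word_sqr adjw_true.
apply: le_trans (growth pK).
rewrite addnn -!muln2 !natrM !mulrA.
apply: (ler_wpM2r (norm2_ge0 p)); apply: le_trans tau_word.
by apply: swap_arith; rewrite ?normr_ge0 ?ler_nat.
Qed.

(** * Expectations of a local operator between two words *)

Section Sandwich.
Hypothesis word_norm : forall w, (size w <= K)%N ->
  ketnorm (wop w *m phi) ^+ 2 <= 2 * norm2 (size w).

(** Bound for the norm of a word of length [p] applied to [phi]. *)
Definition scale : nat -> R := sval (seal (fun p => Num.sqrt (2 * norm2 p))).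

Let scaleE p : scale p = Num.sqrt (2 * norm2 p).
Proof. by rewrite /scale (svalP (seal _)). Qed.

(** The gain for each missing letter: [scale p <= delta * scale p.+1]. *)
Definition delta : R := sval (seal (Num.sqrt tau)^-1).

Let deltaE : delta = (Num.sqrt tau)^-1.
Proof. exact: svalP (seal _). Qed.

Let scale_ge0 p : 0 <= scale p.
Proof. by rewrite scaleE sqrtr_ge0. Qed.

Let scale_sqr p : scale p ^+ 2 = 2 * norm2 p.
Proof. by rewrite scaleE sqr_sqrtr // mulr_ge0. Qed.

Let delta_ge0 : 0 <= delta.
Proof. by rewrite deltaE invr_ge0 sqrtr_ge0. Qed.

Let word_norm_scale w : (size w <= K)%N ->
  ketnorm (wop w *m phi) <= scale (size w).
Proof.
move=> sz; rewrite -(@ler_pXn2r _ 2) ?nnegrE ?ketnorm_ge0 // scale_sqr.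
exact: word_norm.
Qed.

Let scale_growth p : (p < K)%N -> scale p <= delta * scale p.+1.
Proof.
move=> pK; have sqrt_gt0 : 0 < Num.sqrt tau by rewrite sqrtr_gt0.
rewrite deltaE mulrC ler_pdivlMr // -(@ler_pXn2r _ 2) ?nnegrE ?mulr_ge0 ?sqrtr_ge0 //.
rewrite exprMn !scale_sqr (sqr_sqrtr (ltW tau_gt0)) -mulrA ler_pM2l // mulrC.
exact: growth.
Qed.

(** Size of an expectation with [n] letters when these are shared between bra and ket as evenly as
    possible. *)
Definition level : nat -> R :=
  sval (seal (fun n => scale n./2 * scale (uphalf n))).

Let levelE n : level n = scale n./2 * scale (uphalf n).
Proof. by rewrite /level (svalP (seal _)). Qed.

Let level_ge0 n : 0 <= level n.
Proof. by rewrite levelE mulr_ge0. Qed.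

Let level_growth n : (n < K.*2)%N -> level n <= delta * level n.+1.
Proof.
move=> nK; rewrite !levelE /= mulrCA mulrC ler_wpM2l //.
by apply: scale_growth; lia.
Qed.

(** When the lengths differ by at most one, neither side exceeds [K] letters, so [word_norm] applies
    to both after Cauchy-Schwarz. *)
Let sandwich_balanced u B v b : 0 <= b -> loc b B -> (size u + size v <= K.*2)%N ->
  (size u <= (size v).+1)%N -> (size v <= (size u).+1)%N ->
  cabs (mean (wop u * B * wop v)) <= b * level (size u + size v).
Proof.
move=> b_ge0 hB szK suv svu; rewrite exE -!mulmxA braket_adj wop_adj.
apply: le_trans (cauchy_schwarz _ _) _.
have -> : level (size u + size v) = scale (size u) * scale (size v).
  have [le|le] := leqP (size u) (size v).
    by rewrite levelE; congr (scale _ * scale _); lia.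
  by rewrite levelE mulrC; congr (scale _ * scale _); lia.
rewrite mulrCA; apply: ler_pM; rewrite ?ketnorm_ge0 //.
  by rewrite -(size_adjw u); apply: word_norm_scale; rewrite size_adjw; lia.
apply: le_trans (loc_bound _ hB) _; rewrite ler_wpM2l //.
by apply: word_norm_scale; lia.
Qed.

(* If one side is longer, move its last letter through [B]; the commutator
   loses one letter, hence a factor [delta], against the factor [g]. *)
Let sandwich_pow j u B v b : 0 <= b -> loc b B -> (size u + size v <= K.*2)%N ->
  (size u <= size v + j.+1)%N -> (size v <= size u + j.+1)%N ->
  cabs (mean (wop u * B * wop v)) <= b * (1 + g * delta) ^+ j * level (size u + size v).
Proof.
elim: j u B v b => [|j IH] u B v b b_ge0 hB szK suv svu.
  by rewrite expr0 mulr1; apply: sandwich_balanced; rewrite // -addn1.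
have t0 : 0 <= g * delta by exact: mulr_ge0.
(* The commutator term has one letter fewer, and [level_growth] converts this into [delta]; the two
   terms together produce one more factor [1 + g delta]. *)
have step (c1 c2 : R[i]) n : (0 < n <= K.*2)%N ->
    cabs c1 <= b * (1 + g * delta) ^+ j * level n ->
    cabs c2 <= g * b * (1 + g * delta) ^+ j * level n.-1 ->
    cabs (c1 + c2) <= b * (1 + g * delta) ^+ j.+1 * level n.
  case: n => // n /= nK h1 h2; apply: le_trans (cabsD _ _) _.
  apply: le_trans (lerD h1 h2) _.
  have := ler_wpM2l (_ : 0 <= g * b * (1 + g * delta) ^+ j) (level_growth nK).
  move=> /(_ ltac:(by rewrite !mulr_ge0 // exprn_ge0 // addr_ge0)).
  rewrite exprSr; move: (_ ^+ j) (level _) (level _) => x y z h.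
  by apply: le_trans (lerD (lexx _) h) _; rewrite le_eqVlt; apply/orP; left; apply/eqP; ring.
have loc_letter c : loc (g * b) (letter c * B - B * letter c).
  by case: c; [exact: locP | exact: locQ].
have gb0 : 0 <= g * b by exact: mulr_ge0.
have [lt_vu|le_uv] := ltnP (size v).+1 (size u).
  case/lastP: u => [|u c] in szK suv svu lt_vu *; first by [].
  rewrite size_rcons in szK suv svu lt_vu *.
  have -> : wop (rcons u c) * B * wop v =
      wop u * B * wop (c :: v) + wop u * (letter c * B - B * letter c) * wop v.
    rewrite -cats1 wop_cat !wop_cons wop_nil mulr1 mulrBr mulrBl !mulrA.
    by rewrite addrC subrK.
  rewrite exD; apply: step; first by lia.
    have := IH u B (c :: v) b b_ge0 hB; rewrite /= addnS; apply; lia.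
  by have := IH u _ v _ gb0 (loc_letter c); rewrite addSn; apply; lia.
have [lt_uv|le_vu] := ltnP (size u).+1 (size v); last first.
  apply: le_trans (sandwich_balanced b_ge0 hB szK le_uv le_vu) _.
  by rewrite ler_wpM2r // ler_peMr // exprn_ege1 // lerDl.
case: v => [|c v] in szK suv svu le_uv lt_uv *; first by [].
have -> : wop u * B * wop (c :: v) =
    wop (rcons u c) * B * wop v - wop u * (letter c * B - B * letter c) * wop v.
  rewrite -cats1 wop_cat !wop_cons wop_nil mulr1 mulrBr mulrBl !mulrA.
  by rewrite opprB addrC subrK.
rewrite exB; apply: step; first by move: szK => /=; lia.
  have -> : (size u + size (c :: v) = size (rcons u c) + size v)%N.
    by rewrite size_rcons addnS addSn.
  by apply: IH => //; rewrite size_rcons; move: szK suv svu lt_uv => /=; lia.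
rewrite normcN /= addnS /=.
by apply: (IH u _ v _ gb0 (loc_letter c)); move: szK suv svu lt_uv => /=; lia.
Qed.

(** At most [2 K] moves balance the two sides, and [tau_g] makes [2 K g delta <= 1/2], so the
    accumulated factor is at most [2]. *)
Lemma sandwich_bound u B v b : 4 * K%:R * g <= Num.sqrt tau -> 0 <= b -> loc b B ->
  (size u + size v <= K.*2)%N ->
  cabs (mean (wop u * B * wop v)) <= 2 * b * level (size u + size v).
Proof.
move=> tau_g b0' hB sz; have t0 : 0 <= g * delta by exact: mulr_ge0.
apply: le_trans (@sandwich_pow K.*2 u B v b b0' hB sz _ _) _; try lia.
rewrite ler_wpM2r // mulrC ler_wpM2r //.
have := bernoulli_inv K.*2 t0.
have : K.*2%:R * (g * delta) <= 1 / 2.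
  rewrite deltaE !mulrA ler_pdivrMr ?sqrtr_gt0 // -muln2 natrM.
  by move: tau_g; lra.
have : 0 <= (1 + g * delta) ^+ K.*2 by rewrite exprn_ge0 // addr_ge0.
by move: (_ ^+ _) (_ * (g * delta)) => x y; nra.
Qed.

(** * Expansion of the double commutator and the energy estimate *)

Section DoubleCommutator.
Hypothesis sandwich : forall u B v b, 0 <= b -> loc b B ->
  (size u + size v <= K.*2)%N ->
  cabs (mean (wop u * B * wop v)) <= 2 * b * level (size u + size v).

Definition commPH := P * H - H * P.

Let level2 n : (n < K)%N -> level n.*2 <= 2 / tau * norm2 n.+1.
Proof.
move=> nK; rewrite levelE doubleK uphalf_double -expr2 scale_sqr.
rewrite -mulrA ler_pM2l // mulrC ler_pdivlMr // mulrC; exact: growth.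
Qed.

Definition charge_bound : R := sval (seal (2 * (`|mu| + 2 * K%:R))).

Let charge_boundE : charge_bound = 2 * (`|mu| + 2 * K%:R).
Proof. exact: svalP (seal _). Qed.

Let charge_bound_ge n : (n <= K.*2)%N -> 2 * (`|mu| + n%:R) <= charge_bound.
Proof.
by move=> nK; rewrite charge_boundE ler_pM2l // lerD2l -natrM ler_nat mul2n.
Qed.

Let gb_ge0 : 0 <= g * b0. Proof. exact: mulr_ge0. Qed.

(** Everything to the right of [P Q - Q P], including [[P, H]], has a definite charge, so the
    commutator becomes a number and a sandwich of [[P, H]] remains. *)
Let charge_right x y z n : (size x + size y + size z + n.+2 = K.*2)%N ->
  cabs (mean (wop x * (P * Q - Q * P) * (wop y * commPH * wop z))) <=
  charge_bound * (2 * (g * b0) * level (size x + size y + size z)).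
Proof.
move=> sz; apply: le_trans (ex_charge _ (n := size y + 1 + size z) _) _.
  apply: charge_leM; last exact: charge_le_word.
  by apply: charge_leM; [exact: charge_le_word | exact: charge_leD].
apply: ler_pM; rewrite ?mulr_ge0 ?addr_ge0 ?cabs_ge0 //.
  by apply: charge_bound_ge; lia.
rewrite [X in mean X]mulrA [X in mean (X * _)]mulrA -wop_cat -(size_cat x y).
by apply: sandwich; rewrite ?size_cat //; lia.
Qed.

Let charge_left x y z n : (size x + size y + size z + n.+2 = K.*2)%N ->
  cabs (mean (wop x * commPH * wop y * (P * Q - Q * P) * wop z)) <=
  charge_bound * (2 * (g * b0) * level (size x + size y + size z)).
Proof.
move=> sz; apply: le_trans (ex_charge _ (charge_le_word z)) _.
apply: ler_pM; rewrite ?mulr_ge0 ?addr_ge0 ?cabs_ge0 //.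
  by apply: charge_bound_ge; lia.
rewrite -[X in mean X]mulrA -wop_cat -addnA -(size_cat y z).
by apply: sandwich; rewrite ?size_cat //; lia.
Qed.

(** Of the [2 K] letters, one [P] is absorbed into [[P, H]] and a pair [P], [Q] becomes a charge,
    which leaves [2 K - 3]. *)
Let odd_cost := charge_bound * (2 * (g * b0) * level (K.*2 - 3)).

Let odd_cost_ge0 : 0 <= odd_cost.
Proof. by rewrite /odd_cost charge_boundE !mulr_ge0 // addr_ge0 // mulr_ge0. Qed.

Let commutator_left i k l j : (i + j).+1 = K -> (k + l).+1 = K ->
  cabs (mean (Q ^+ i * ((P ^+ k * Q - Q * P ^+ k) * commPH * P ^+ l) * Q ^+ j))
  <= k%:R * odd_cost.
Proof.
move=> ij kl; rewrite commutator_exp !mulr_suml mulr_sumr mulr_suml ex_sum.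
apply: le_trans (cabs_sum _ _ _) _.
rewrite mulr_natl -[X in _ *+ X]card_ord -sumr_const ler_sum // => -[p pk] _ /=.
have -> : Q ^+ i * (P ^+ p * (P * Q - Q * P) * P ^+ (k.-1 - p) * commPH * P ^+ l) * Q ^+ j =
    wop (nseq i false ++ nseq p true) * (P * Q - Q * P) *
    (wop (nseq (k.-1 - p) true) * commPH * wop (nseq l true ++ nseq j false)).
  by rewrite !wop_cat -!P_exp_word -!Q_exp_word !mulrA.
apply: le_trans (charge_right (n := 1) _) _; rewrite !size_cat !size_nseq; first lia.
by have -> : (i + p + (k.-1 - p) + (l + j) = K.*2 - 3)%N by lia.
Qed.

Let commutator_right i k l j : (i + j).+1 = K -> (k + l).+1 = K ->
  cabs (mean (Q ^+ i * (P ^+ k * commPH * (P ^+ l * Q - Q * P ^+ l)) * Q ^+ j))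
  <= l%:R * odd_cost.
Proof.
move=> ij kl; rewrite commutator_exp !mulr_sumr mulr_suml ex_sum.
apply: le_trans (cabs_sum _ _ _) _.
rewrite mulr_natl -[X in _ *+ X]card_ord -sumr_const ler_sum // => -[p pl] _ /=.
have -> : Q ^+ i * (P ^+ k * commPH * (P ^+ p * (P * Q - Q * P) * P ^+ (l.-1 - p))) * Q ^+ j =
    wop (nseq i false ++ nseq k true) * commPH * wop (nseq p true) * (P * Q - Q * P) *
    wop (nseq (l.-1 - p) true ++ nseq j false).
  by rewrite !wop_cat -!P_exp_word -!Q_exp_word !mulrA.
apply: le_trans (charge_left (n := 1) _) _; rewrite !size_cat !size_nseq; first lia.
by have -> : (i + k + p + (l.-1 - p + j) = K.*2 - 3)%N by lia.
Qed.

(** Here both letters are absorbed: [[Q, [P, H]]] is local with bound [g^2 b0], and [2 K - 2]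
    letters surround it. *)
Let commutator_mid i k l j : (i + j).+1 = K -> (k + l).+1 = K ->
  cabs (mean (Q ^+ i * (P ^+ k * (Q * commPH - commPH * Q) * P ^+ l) * Q ^+ j))
  <= 2 * (g * (g * b0)) * level (K.*2 - 2).
Proof.
move=> ij kl.
have -> : Q ^+ i * (P ^+ k * (Q * commPH - commPH * Q) * P ^+ l) * Q ^+ j =
    wop (nseq i false ++ nseq k true) * (Q * commPH - commPH * Q) *
    wop (nseq l true ++ nseq j false).
  by rewrite !wop_cat -!P_exp_word -!Q_exp_word !mulrA.
apply: le_trans (sandwich _ (locQ locH) _) _; rewrite ?size_cat ?size_nseq ?mulr_ge0 //.
  by lia.
by have -> : (i + k + (l + j) = K.*2 - 2)%N by lia.
Qed.

(** One term with the nested commutator, plus [k + l = K - 1] charge terms coming from the powers of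
    [P] on either side of [[P, H]]. *)
Let term_cost : R := 2 * (g * (g * b0)) * level (K.*2 - 2) + (K.-1)%:R * odd_cost.

Let term_bound i k l j : (i + j).+1 = K -> (k + l).+1 = K ->
  cabs (mean (Q ^+ i * (Q * (P ^+ k * commPH * P ^+ l) - P ^+ k * commPH * P ^+ l * Q) * Q ^+ j))
  <= term_cost.
Proof.
move=> ij kl.
rewrite commutator_sandwich.
have sub (A B : 'M[R[i]]_N) :
    mean (Q ^+ i * (A - B) * Q ^+ j) = mean (Q ^+ i * A * Q ^+ j) - mean (Q ^+ i * B * Q ^+ j).
  by rewrite mulrBr mulrBl exB.
rewrite 2!sub; apply: le_trans (cabsB _ _) _.
apply: le_trans (lerD (cabsB _ _) (commutator_right ij kl)) _.
rewrite -addrA; apply: lerD; first exact: commutator_mid.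
apply: le_trans (lerD (commutator_left ij kl) (lexx _)) _.
by rewrite -mulrDl -natrD ler_wpM2r // ler_nat -kl.
Qed.

Let double_commutator :
  cabs (mean (Q ^+ K * (P ^+ K * H - H * P ^+ K) - (P ^+ K * H - H * P ^+ K) * Q ^+ K))
  <= K%:R ^+ 2 * term_cost.
Proof.
rewrite commutator_exp ex_sum; apply: le_trans (cabs_sum _ _ _) _.
rewrite expr2 -mulrA mulr_natl -[X in _ *+ X]card_ord -sumr_const ler_sum // => i _.
rewrite commutator_exp mulr_sumr mulr_suml -sumrB mulr_sumr mulr_suml ex_sum.
apply: le_trans (cabs_sum _ _ _) _.
rewrite mulr_natl -[X in _ *+ X]card_ord -sumr_const ler_sum // => k _.
by apply: term_bound; have := ltn_ord i; have := ltn_ord k; lia.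
Qed.

Let term_cost_le : (0 < K)%N -> term_cost <=
  norm2 K * (g * b0 / tau * (4 * g + 8 * K%:R * (`|mu| + 2 * K%:R) / Num.sqrt tau)).
Proof.
move=> K0; rewrite /term_cost /odd_cost charge_boundE.
have le2 : level (K.*2 - 2) <= 2 / tau * norm2 K.
  have -> : (K.*2 - 2 = K.-1.*2)%N by lia.
  by rewrite -[in norm2 K](prednK K0); apply: level2; lia.
have le3 : (K.-1)%:R * level (K.*2 - 3) <= K%:R * (delta * (2 / tau * norm2 K)).
  (* For [K = 1] the truncated difference [2 K - 3] is meaningless, but the factor [K - 1]
     vanishes. *)
  have [K1|K1] := leqP K 1.
    have -> : K.-1 = 0%N by lia.
    by rewrite mul0r !mulr_ge0 // invr_ge0 ltW.
  apply: ler_pM; rewrite ?ler_nat ?leq_pred //.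
  have size_eq : (K.*2 - 2 = (K.*2 - 3).+1)%N by lia.
  rewrite size_eq in le2.
  apply: le_trans (level_growth _) _; first by lia.
  by rewrite ler_wpM2l.
have cost_ge0 : 0 <= 2 * (`|mu| + 2 * K%:R) * (2 * (g * b0)).
  by rewrite !mulr_ge0 // addr_ge0 // mulr_ge0.
have {}le2 := ler_wpM2l (_ : 0 <= 2 * (g * (g * b0))) le2.
have {}le2 := le2 ltac:(by rewrite !mulr_ge0).
have {}le3 := ler_wpM2l cost_ge0 le3.
rewrite deltaE in le3.
rewrite [X in _ + X](_ : _ = 2 * (`|mu| + 2 * K%:R) * (2 * (g * b0)) *
  ((K.-1)%:R * level (K.*2 - 3))); last first.
  by move: (level _) (_.-1)%:R (`|mu|) (K%:R : R) => x y z t; ring.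
apply: le_trans (lerD le2 le3) _; rewrite le_eqVlt; apply/orP; left; apply/eqP.
move: (norm2 K) (K%:R) (`|mu|) (tau^-1) (Num.sqrt tau)^-1 => x y z t u.
by ring.
Qed.

(* Both [<H>] in [P^K phi] and in [Q^K phi] are nonnegative, and since [H phi = 0]
   their sum is the expectation of a double commutator. *)
Lemma tower_energy : (0 < K)%N -> (forall v, 0 <= braket v (H *m v)) ->
  braket (P ^+ K *m phi) (H *m (P ^+ K *m phi)) <=
  (norm2 K * (K%:R ^+ 2 * (g * b0 / tau *
     (4 * g + 8 * K%:R * (`|mu| + 2 * K%:R) / Num.sqrt tau))))%:C.
Proof.
move=> K0 H_ge0.
have adj_exp (A : 'M[R[i]]_N) : (A ^+ K)^t* = (A^t*) ^+ K.
  elim: K => [|n IH]; first by rewrite !expr0 trmx1 map_mx1.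
  by rewrite exprS exprSr -IH trmx_mul map_mxM.
have exP : braket (P ^+ K *m phi) (H *m (P ^+ K *m phi)) = mean (Q ^+ K * H * P ^+ K).
  by rewrite exE -!mulmxA [RHS]braket_adj adj_exp adjQ.
have exQ : braket (Q ^+ K *m phi) (H *m (Q ^+ K *m phi)) = mean (P ^+ K * H * Q ^+ K).
  by rewrite exE -!mulmxA [RHS]braket_adj adj_exp adjP.
have sum_eq : mean (Q ^+ K * (P ^+ K * H - H * P ^+ K)
      - (P ^+ K * H - H * P ^+ K) * Q ^+ K) =
    - (mean (Q ^+ K * H * P ^+ K) + mean (P ^+ K * H * Q ^+ K)).
  have e1 : mean (Q ^+ K * (P ^+ K * H)) = 0.
    by rewrite exE -!mulmxA Hphi !mulmx0 braket0r.
  have e2 : mean (H * P ^+ K * Q ^+ K) = 0.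
    by rewrite exE -!mulmxA braket_adj adjH Hphi braket0l.
  rewrite exB opprD; congr (_ - _).
    by rewrite mulrBr exB e1 sub0r mulrA.
  by rewrite mulrBl exB -[RHS]subr0; congr (_ - _).
have le_sum : braket (P ^+ K *m phi) (H *m (P ^+ K *m phi)) <=
    `|mean (Q ^+ K * H * P ^+ K) + mean (P ^+ K * H * Q ^+ K)|.
  by rewrite -exP -exQ ger0_norm ?addr_ge0 // lerDl.
apply: le_trans le_sum _; rewrite -normrN -sum_eq cabsE lecR.
apply: le_trans double_commutator _.
by rewrite mulrCA ler_wpM2l ?sqr_ge0 // term_cost_le.
Qed.

End DoubleCommutator.
End Sandwich.
End Energy.

Lemma tower_bound : 2 * tau - `|mu| <= ketnorm (P *m phi) ^+ 2 ->
  (2 * K%:R + 1) * `|mu| + K%:R * (K%:R + 1) <= tau ->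
  16 * K%:R ^+ 2 * (`|mu| + 2 * K%:R) <= tau -> 4 * K%:R * g <= Num.sqrt tau ->
  (0 < K)%N -> (forall v, 0 <= braket v (H *m v)) ->
  0 < ketnorm (P ^+ K *m phi) ^+ 2 /\
  braket (P ^+ K *m phi) (H *m (P ^+ K *m phi)) <=
  (ketnorm (P ^+ K *m phi) ^+ 2 * (K%:R ^+ 2 * (g * b0 / tau *
     (4 * g + 8 * K%:R * (`|mu| + 2 * K%:R) / Num.sqrt tau))))%:C.
Proof.
have -> : P *m phi = P ^+ 1 *m phi by rewrite expr1.
rewrite !norm2E => norm2_1 tau_mu tau_word tau_g K0 H_ge0.
have grow k (kK : (k < K)%N) := norm2_growth norm2_1 tau_mu kK.
have grow2 k (kK : (k < K)%N) : tau * norm2 k <= norm2 k.+1 by have [] := grow k kK.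
split.
  have [|pos le] := grow K.-1; first by rewrite prednK.
  by move: le; rewrite prednK //; apply: lt_le_trans; apply: mulr_gt0.
have word_norm w (wK : (size w <= K)%N) := word_norm_sqr grow2 tau_word wK erefl.
by apply: (tower_energy grow2 _ K0 H_ge0) => u B v b; exact: sandwich_bound.
Qed.

End Tower.

(** * Operators on disjoint sets of sites commute *)

Section Locality.
Variables (R : realType) (n : nat) (X : finType).

(** Each factor is diagonal off its own set, so a single intermediate configuration [u] contributes:
    it agrees with [t] on [S] and with [s] elsewhere. The resulting entry is symmetric in the two
    factors, which yields commutation. *)
Lemma mul_tensor_id (S T : {set X}) (A : 'M[R[i]]_(tdim {x | x \in S} n))
    (B : 'M[R[i]]_(tdim {x | x \in T} n)) (i j : 'I_(tdim X n)) :
  [disjoint S & T] ->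
  (tensor_id A *m tensor_id B) i j =
  if [forall x, (x \notin S :|: T) ==> (enum_val i x == enum_val j x)]
  then entry A (restr S (enum_val i)) (restr S (enum_val j)) *
       entry B (restr T (enum_val i)) (restr T (enum_val j)) else 0.
Proof.
move=> dST; set s := enum_val i; set t := enum_val j.
pose u : {ffun X -> 'I_n} := [ffun x => if x \in S then t x else s x].
rewrite mxE (bigD1 (enum_rank u)) //= big1 ?addr0 => [|k ku]; last first.
  rewrite !mxE -/s -/t; case: ifP => [/forallP su|]; last by rewrite mul0r.
  case: ifP => [/forallP ut|]; last by rewrite mulr0.
  case/eqP: ku; apply: (canRL enum_valK); apply/ffunP => x; rewrite ffunE.
  case: ifP => [xS|xS]; last by have := su x; rewrite xS => /eqP.
  by have := ut x; rewrite (disjointFr dST xS) => /eqP.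
rewrite !mxE -/s -/t enum_rankK ifT; last first.
  by apply/forallP => x; apply/implyP => xS; rewrite ffunE (negPf xS).
have -> : restr S u = restr S t.
  by apply/ffunP => x; rewrite !ffunE (valP x).
have -> : restr T u = restr T s.
  by apply/ffunP => x; rewrite !ffunE (disjointFl dST (valP x)).
have -> : [forall x, (x \notin T) ==> (u x == t x)] =
          [forall x, (x \notin S :|: T) ==> (s x == t x)].
  apply: eq_forallb => x; rewrite ffunE inE negb_or.
  by case: (x \in S) => //=; rewrite eqxx implybT.
by case: ifP => // _; rewrite mulr0.
Qed.

Lemma acts_on_commute (S T : {set X}) (A B : 'M[R[i]]_(tdim X n)) :
  [disjoint S & T] -> acts_on S A -> acts_on T B -> A * B = B * A.
Proof.
move=> dST [A' ->] [B' ->]; apply/matrixP => i j.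
have dTS : [disjoint T & S] by rewrite disjoint_sym.
by rewrite (mul_tensor_id _ _ _ _ dST) (mul_tensor_id _ _ _ _ dTS) finset.setUC mulrC.
Qed.

End Locality.

(** * Sums of local operators and their commutators with the order operators *)

Section LocalSum.
Variables (R : realType) (N : nat) (X : finType) (o1 o2 : X -> 'M[R[i]]_N).
Hypothesis comm_sites : forall z w, z != w ->
  [/\ o1 z * o1 w = o1 w * o1 z, o1 z * o2 w = o2 w * o1 z &
      o2 z * o2 w = o2 w * o2 z].

(** The support [S x] of a term is encoded only through commutation with the site operators outside
    it. The budget [b] is shared equally among the sites. *)
Definition local_sum (S : X -> {set X}) (b : R) (B : 'M[R[i]]_N) :=
  0 <= b /\ exists f : X -> 'M[R[i]]_N,
  [/\ B = \sum_x f x, forall x v, ketnorm (f x *m v) <= b / #|X|%:R * ketnorm v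
    & forall x z, z \notin S x -> f x * o1 z = o1 z * f x /\ f x * o2 z = o2 z * f x].

Lemma local_sum_bound S b B v : (0 < #|X|)%N -> local_sum S b B ->
  ketnorm (B *m v) <= b * ketnorm v.
Proof.
move=> X0 [b0 [f [-> fb _]]]; rewrite mulmx_suml.
apply: le_trans (ketnorm_sum _ _ _) _.
apply: le_trans (ler_sum _ (fun x _ => fb x v)) _.
by rewrite sumr_const -[_ *+ _]mulr_natr mulrAC divfK // pnatr_eq0 -lt0n.
Qed.

(** Only the at most [zeta] sites of [S x] contribute to the commutator with [f x], each at norm
    [2 o0 b / #|X|]. Since [p z] is a single-site operator, the supports do not grow. *)
Lemma local_sum_commutator (S : X -> {set X}) b B (o0 : R) (zeta : nat) (p : X -> 'M[R[i]]_N)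
    (c : R[i]) :
  0 <= o0 -> (forall x, p x = o1 x + c *: o2 x) -> (forall x, #|S x| <= zeta)%N ->
  (forall x v, ketnorm (p x *m v) <= o0 * ketnorm v) ->
  local_sum S b B ->
  local_sum S (2 * zeta%:R * o0 * b) ((\sum_x p x) * B - B * \sum_x p x).
Proof.
move=> o0_ge0 pE Sz pb [b0 [f [-> fb fc]]]; split; first by rewrite !mulr_ge0.
have scaleAl (A B' : 'M[R[i]]_N) : (c *: A) * B' = c *: (A * B').
  exact: esym (scalemxAl _ _ _).
have scaleAr (A B' : 'M[R[i]]_N) : A * (c *: B') = c *: (A * B').
  exact: esym (scalemxAr _ _ _).
have pc A z : A * o1 z = o1 z * A -> A * o2 z = o2 z * A -> A * p z = p z * A.
  by move=> h1 h2; rewrite pE mulrDr mulrDl scaleAl scaleAr h1 h2.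
have pcw z w : z != w -> p z * o1 w = o1 w * p z /\ p z * o2 w = o2 w * p z.
  move=> zw; have [h1 h2 h3] := comm_sites zw.
  have [_ h4 _] : [/\ True, o2 z * o1 w = o1 w * o2 z & True].
    by rewrite eq_sym in zw; have [_ -> _] := comm_sites zw.
  by rewrite pE !mulrDl !mulrDr !scaleAl !scaleAr h1 h2 h3 h4.
exists (fun x => \sum_(z in S x) (p z * f x - f x * p z)); split.
- rewrite mulr_suml mulr_sumr -sumrB.
  under eq_bigr => z _ do rewrite mulr_sumr mulr_suml -sumrB.
  rewrite exchange_big; apply: eq_bigr => x _ /=.
  rewrite (bigID (mem (S x))) /= [X in _ + X]big1 ?addr0 // => z zS.
  by have [h1 h2] := fc x z zS; rewrite (pc _ _ h1 h2) subrr.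
- move=> x v; rewrite mulmx_suml; apply: le_trans (ketnorm_sum _ _ _) _.
  have c0 : 0 <= b / #|X|%:R by rewrite divr_ge0.
  have term z : ketnorm ((p z * f x - f x * p z) *m v) <=
      2 * o0 * (b / #|X|%:R) * ketnorm v.
    rewrite mulmxBl -!mulmxA; apply: le_trans (ketnormB _ _) _.
    have h1 := le_trans (pb z (f x *m v)) (ler_wpM2l o0_ge0 (fb x v)).
    have h2 := le_trans (fb x (p z *m v)) (ler_wpM2l c0 (pb z v)).
    apply: le_trans (lerD h1 h2) _; rewrite le_eqVlt; apply/orP; left; apply/eqP.
    by move: (b / _) (ketnorm v) => e k; ring.
  apply: le_trans (ler_sum _ (fun z _ => term z)) _.
  rewrite sumr_const -[_ *+ _]mulr_natl.
  have := ler_wpM2r (_ : 0 <= 2 * o0 * (b / #|X|%:R) * ketnorm v)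
            (_ : #|S x|%:R <= zeta%:R :> R).
  rewrite ler_nat => /(_ _ (Sz x)) h; apply: le_trans (h _) _.
    by rewrite !mulr_ge0 ?ketnorm_ge0 // invr_ge0.
  rewrite le_eqVlt; apply/orP; left; apply/eqP.
  by move: (#|X|%:R^-1) (ketnorm v) => e k; ring.
- move=> x w wS; have [h1 h2] := fc x w wS.
  by split; rewrite mulr_suml mulr_sumr; apply: eq_bigr => z zS;
    have zw : z != w by [apply: contraNneq wS => <-];
    have [h3 h4] := pcw z w zw;
    rewrite mulrBl mulrBr -!mulrA ?h1 ?h2 ?h3 ?h4 !mulrA ?h1 ?h2 ?h3 ?h4.
Qed.

End LocalSum.

(** * Explicit constants and the inequalities they satisfy *)

Section Constants.
Variables (R : realType) (o g h q : R).

(** The reciprocal of a sum of nonnegative terms meets several smallness conditions at once, one for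
    each summand; see [radius_bounds]. *)
Definition tower_radius : R := (1 + (16 * o ^+ 2 + 32) / q + 4 * g / Num.sqrt q)^-1.
Definition quadratic_rate : R := 1 + g * h / q * (4 * g + 16 / Num.sqrt q).
Definition cubic_rate : R := 1 + g * h / q * (4 * g + (8 * o ^+ 2 + 16) / Num.sqrt q).

Hypotheses (g_ge0 : 0 <= g) (h_ge0 : 0 <= h) (q_gt0 : 0 < q).

Let sqrt_q_gt0 : 0 < Num.sqrt q. Proof. by rewrite sqrtr_gt0. Qed.

Let iq_ge0 : 0 <= q^-1. Proof. by rewrite invr_ge0 ltW. Qed.

Let isq_ge0 : 0 <= (Num.sqrt q)^-1. Proof. by rewrite invr_ge0 ltW. Qed.

Let o2_ge0 : 0 <= o ^+ 2. Proof. exact: sqr_ge0. Qed.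

Lemma tower_radius_gt0 : 0 < tower_radius.
Proof.
have h1 : 0 <= (16 * o ^+ 2 + 32) / q by rewrite mulr_ge0 // addr_ge0 // mulr_ge0.
have h2 : 0 <= 4 * g / Num.sqrt q by rewrite !mulr_ge0.
by rewrite invr_gt0; move: h1 h2; lra.
Qed.

Lemma quadratic_rate_gt0 : 0 < quadratic_rate.
Proof. by rewrite ltr_pwDl // !mulr_ge0 // addr_ge0 // !mulr_ge0. Qed.

Lemma cubic_rate_gt0 : 0 < cubic_rate.
Proof. by rewrite ltr_pwDl // !mulr_ge0 // addr_ge0 // !mulr_ge0 // addr_ge0 // mulr_ge0. Qed.

Let radius_bounds : [/\ tower_radius <= 1, tower_radius * (16 * o ^+ 2 + 32) <= q &
  tower_radius * (4 * g) <= Num.sqrt q].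
Proof.
have := tower_radius_gt0; rewrite /tower_radius invr_gt0.
set D := (1 + _ + _) => D0.
have h1 : 0 <= (16 * o ^+ 2 + 32) / q by rewrite mulr_ge0 // addr_ge0 // mulr_ge0.
have h2 : 0 <= 4 * g / Num.sqrt q by rewrite !mulr_ge0.
have D1 : 1 <= D by rewrite /D; lra.
have D2 : (16 * o ^+ 2 + 32) / q <= D by rewrite /D; lra.
have D3 : 4 * g / Num.sqrt q <= D by rewrite /D; lra.
split; first by rewrite invf_le1.
- by rewrite mulrC ler_pdivrMr // [q * D]mulrC -ler_pdivrMr.
- by rewrite mulrC ler_pdivrMr // [Num.sqrt q * D]mulrC -ler_pdivrMr.
Qed.

Variables (V k mu : R).
Hypotheses (V_ge1 : 1 <= V) (k_ge1 : 1 <= k) (k_le : k <= tower_radius * Num.sqrt V)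
  (mu_le : `|mu| <= o ^+ 2 * V).

Let tau := q * V ^+ 2.

Let V_gt0 : 0 < V. Proof. exact: lt_le_trans V_ge1. Qed.

Let k_ge0 : 0 <= k. Proof. exact: le_trans k_ge1. Qed.

Let sqrt_V_le : Num.sqrt V <= V.
Proof.
rewrite -{2}(sqr_sqrtr (ltW V_gt0)) expr2 ler_peMr ?sqrtr_ge0 //.
by rewrite -sqrtr1 ler_wsqrtr.
Qed.

Let k_leV : k <= tower_radius * V.
Proof.
apply: le_trans k_le _; rewrite ler_wpM2l //; exact: ltW tower_radius_gt0.
Qed.

Let k_leV1 : k <= V.
Proof.
have [r1 _ _] := radius_bounds; apply: le_trans k_leV _.
by rewrite ler_piMl // ltW.
Qed.

(** Here the square root in the range of [k] counts; elsewhere the weaker [k <= tower_radius * V] is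
    used. *)
Let sqr_k_le : k ^+ 2 <= tower_radius * V.
Proof.
have [r1 _ _] := radius_bounds.
have r0 := ltW tower_radius_gt0.
have : k ^+ 2 <= (tower_radius * Num.sqrt V) ^+ 2.
  by rewrite ler_pXn2r ?nnegrE ?mulr_ge0 ?sqrtr_ge0.
rewrite exprMn sqr_sqrtr; last exact: ltW.
move=> /le_trans; apply; rewrite ler_wpM2r ?(ltW V_gt0) //.
by rewrite expr2 ler_piMr.
Qed.

Let sqrt_tau : Num.sqrt tau = Num.sqrt q * V.
Proof. by rewrite sqrtrM ?(ltW q_gt0) // sqrtr_sqr gtr0_norm. Qed.

Let oV_ge0 : 0 <= o ^+ 2 * V. Proof. by rewrite mulr_ge0 // ltW. Qed.

Let tau_word : 16 * k ^+ 2 * (`|mu| + 2 * k) <= tau.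
Proof.
have [_ r2 _] := radius_bounds.
have h1 : `|mu| + 2 * k <= (o ^+ 2 + 2) * V.
  by rewrite (mulrDl (o ^+ 2)) lerD // ler_pM2l.
have h2 : k ^+ 2 * (`|mu| + 2 * k) <= tower_radius * V * ((o ^+ 2 + 2) * V).
  by rewrite ler_pM ?sqr_ge0 ?addr_ge0 ?mulr_ge0.
rewrite -mulrA; apply: le_trans (ler_wpM2l _ h2) _ => //.
have -> : 16 * (tower_radius * V * ((o ^+ 2 + 2) * V)) =
    tower_radius * (16 * o ^+ 2 + 32) * V ^+ 2 by ring.
by rewrite /tau ler_wpM2r ?sqr_ge0.
Qed.

Lemma tower_conditions :
  [/\ (2 * k + 1) * `|mu| + k * (k + 1) <= tau,
      16 * k ^+ 2 * (`|mu| + 2 * k) <= tau & 4 * k * g <= Num.sqrt tau].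
Proof.
split=> //.
(* As [k >= 1], the first condition follows from the second, term by term. *)
- apply: le_trans tau_word; have m0 := normr_ge0 mu.
  have kk : k <= k ^+ 2 by rewrite expr2 ler_peMr.
  have kkk : k ^+ 2 <= k ^+ 2 * k by rewrite ler_peMr // sqr_ge0.
  rewrite [X in _ <= X]mulrDr; apply: lerD; last first.
    have -> : 16 * k ^+ 2 * (2 * k) = 32 * (k ^+ 2 * k) by ring.
    have -> : k * (k + 1) = k ^+ 2 + k by ring.
    by have := sqr_ge0 k; lra.
  by apply: ler_wpM2r => //; move: k_ge1; lra.
- have [_ _ r3] := radius_bounds; rewrite sqrt_tau.
  have h1 := ler_wpM2l (_ : 0 <= 4 * g) k_leV.
  have {}h1 := h1 ltac:(by rewrite mulr_ge0).
  have h2 := ler_wpM2r (ltW V_gt0) r3.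
  apply: le_trans h2; move: h1; move: tower_radius => r h1.
  have -> : 4 * k * g = 4 * g * k by ring.
  by have -> : r * (4 * g) * V = 4 * g * (r * V) by ring.
Qed.

Let energy_rate : k ^+ 2 * (g * (h * V) / tau *
     (4 * g + 8 * k * (`|mu| + 2 * k) / Num.sqrt tau)) =
  k ^+ 2 / V * (g * h / q * (4 * g + 8 * k * (`|mu| + 2 * k) / (Num.sqrt q * V))).
Proof.
have q0 : q != 0 by rewrite gt_eqF.
have V0 : V != 0 by rewrite gt_eqF.
have s0 : Num.sqrt q != 0 by rewrite gt_eqF.
rewrite sqrt_tau /tau; move: (Num.sqrt q) s0 (`|mu|) => s s0 x.
by field; rewrite q0 V0 s0.
Qed.

(** The charge is only known to be of order [V], so [|mu| + 2 k <= (o^2 + 2) V] leaves an extra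
    factor [k]; the term [4 g] is absorbed using [k >= 1]. *)
Lemma cubic_bound : k ^+ 2 * (g * (h * V) / tau *
     (4 * g + 8 * k * (`|mu| + 2 * k) / Num.sqrt tau)) <= cubic_rate * (k ^+ 3 / V).
Proof.
rewrite energy_rate.
have -> : cubic_rate * (k ^+ 3 / V) = k ^+ 2 / V * (cubic_rate * k) by rewrite exprS; ring.
have h0 : 0 <= k ^+ 2 / V by rewrite mulr_ge0 ?sqr_ge0 // invr_ge0 ltW.
rewrite ler_wpM2l // /cubic_rate [X in _ <= X]mulrDl mul1r -[X in X <= _]add0r lerD //.
rewrite -[X in _ <= X]mulrA ler_wpM2l ?mulr_ge0 // [X in _ <= X]mulrDl lerD //.
  by rewrite ler_peMr // mulr_ge0.
rewrite ler_pdivrMr ?mulr_gt0 //.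
have -> : (8 * o ^+ 2 + 16) / Num.sqrt q * k * (Num.sqrt q * V) =
    8 * k * ((o ^+ 2 + 2) * V).
  by move: sqrt_q_gt0; move: (Num.sqrt q) => s s0; field; rewrite gt_eqF.
by rewrite ler_wpM2l ?mulr_ge0 // (mulrDl (o ^+ 2)) lerD // ler_pM2l.
Qed.

(** Without [mu] the charge term is [16 k^2 / (sqrt q V)], which is bounded because [k^2 <= V]. *)
Lemma quadratic_bound : mu = 0 -> k ^+ 2 * (g * (h * V) / tau *
     (4 * g + 8 * k * (`|mu| + 2 * k) / Num.sqrt tau)) <= quadratic_rate * (k ^+ 2 / V).
Proof.
move=> mu0; rewrite energy_rate mu0 normr0 add0r [X in _ <= X]mulrC.
have h0 : 0 <= k ^+ 2 / V by rewrite mulr_ge0 ?sqr_ge0 // invr_ge0 ltW.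
rewrite ler_wpM2l // /quadratic_rate -[X in X <= _]add0r lerD //.
rewrite ler_wpM2l ?mulr_ge0 // lerD //.
rewrite ler_pdivrMr ?mulr_gt0 //.
have [r1 _ _] := radius_bounds.
have -> : 16 / Num.sqrt q * (Num.sqrt q * V) = 16 * V.
  by move: sqrt_q_gt0; move: (Num.sqrt q) => s s0; field; rewrite gt_eqF.
have kV : k ^+ 2 <= V.
  by apply: le_trans sqr_k_le _; rewrite ler_piMl // ltW.
have -> : 8 * k * (2 * k) = 16 * k ^+ 2 by ring.
by rewrite ler_pM2l.
Qed.

End Constants.

(** * The tower for sums of site operators *)

Section LocalTower.
Variables (R : realType) (N : nat) (X : finType) (o1 o2 h : X -> 'M[R[i]]_N).
Variables (S : X -> {set X}) (zeta : nat) (o0 h0 q0 E : R) (phi : 'cV[R[i]]_N).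
Hypotheses (adj1 : forall x, (o1 x)^t* = o1 x) (adj2 : forall x, (o2 x)^t* = o2 x)
  (comm_sites : forall z w, z != w ->
    [/\ o1 z * o1 w = o1 w * o1 z, o1 z * o2 w = o2 w * o1 z &
        o2 z * o2 w = o2 w * o2 z])
  (card_S : forall x, (#|S x| <= zeta)%N)
  (h_local : forall x z, z \notin S x -> h x * o1 z = o1 z * h x /\ h x * o2 z = o2 z * h x)
  (h_bound : forall x v, ketnorm (h x *m v) <= h0 * ketnorm v)
  (X_gt0 : (0 < #|X|)%N) (o0_ge0 : 0 <= o0) (h0_ge0 : 0 <= h0) (q0_gt0 : 0 < q0).
Let V : R := #|X|%:R.
Let O1 : 'M[R[i]]_N := \sum_x o1 x.
Let O2 : 'M[R[i]]_N := \sum_x o2 x.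
Let H : 'M[R[i]]_N := \sum_x h x.
Hypotheses (adjH : H^t* = H) (phi1 : ketnorm phi = 1) (Hphi : H *m phi = E%:C *: phi)
  (gap : forall v, 0 <= braket v ((H - E%:C%:M) *m v))
  (order1 : (q0 * V ^+ 2)%:C <= expval phi (O1 * O1))
  (order2 : (q0 * V ^+ 2)%:C <= expval phi (O2 * O2)).
(* [c] is ['i] for the raising tower; [c = - 'i] together with [- C] and [- mu]
   gives the lowering tower. *)
Variables (c : R[i]) (C : 'M[R[i]]_N) (mu : R).
Hypotheses (conj_c : Num.conj c = - c) (sqr_c : c * c = -1)
  (comm1 : comm O1 C = - c *: O2) (comm2 : comm O2 C = c *: O1)
  (comm12 : comm O1 O2 = c *: C) (CH : comm C H = 0)
  (Cphi : C *m phi = mu%:C *: phi)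
  (raise_bound : forall x v, ketnorm ((o1 x + c *: o2 x) *m v) <= o0 * ketnorm v)
  (lower_bound : forall x v, ketnorm ((o1 x - c *: o2 x) *m v) <= o0 * ketnorm v).

Let P := O1 + c *: O2.
Let Q := O1 - c *: O2.
Let g := 2 * zeta%:R * o0.

Let V_ge1 : 1 <= V. Proof. by rewrite /V ler1n. Qed.

Let PE : P = \sum_x (o1 x + c *: o2 x).
Proof. by rewrite /P big_split /= -scaler_sumr. Qed.

Let adj_sum (f : X -> 'M[R[i]]_N) : (forall x, (f x)^t* = f x) ->
  (\sum_x f x)^t* = \sum_x f x.
Proof.
move=> hf; apply/matrixP => a b; rewrite !mxE !summxE rmorph_sum.
by apply: eq_bigr => x _; rewrite -[in RHS](hf x) !mxE.
Qed.

Let adjP : P^t* = Q.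
Proof.
have adjD (A B : 'M[R[i]]_N) : (A + B)^t* = A^t* + B^t*.
  by apply/matrixP => a b; rewrite !mxE rmorphD.
rewrite /P /Q adjD (adj_sum adj1); congr (_ + _).
have conjE : (c *: O2)^t* = Num.conj c *: O2^t* by apply/matrixP => a b; rewrite !mxE rmorphM.
by rewrite conjE (adj_sum adj2) conj_c scaleNr.
Qed.

Let scaleAl z (A B : 'M[R[i]]_N) : (z *: A) * B = z *: (A * B).
Proof. exact: esym (scalemxAl _ _ _). Qed.

Let scaleAr z (A B : 'M[R[i]]_N) : A * (z *: B) = z *: (A * B).
Proof. exact: esym (scalemxAr _ _ _). Qed.

Let c12 : O1 * O2 = O2 * O1 + c *: C.
Proof. by rewrite -comm12 addrC subrK. Qed.

Let QP : Q * P = O1 * O1 + O2 * O2 - C.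
Proof.
rewrite /P /Q mulrBl !mulrDr !scaleAl !scaleAr scalerA sqr_c scaleN1r c12.
rewrite scalerDr scalerA sqr_c scaleN1r opprD opprK.
move: (O1 * O1) (O2 * O2) (c *: (O2 * O1)) => A B D.
by rewrite -!addrA; congr (A + _); rewrite [- C + _]addrCA addNKr addrC.
Qed.

Let PQ : P * Q = O1 * O1 + O2 * O2 + C.
Proof.
rewrite /P /Q mulrDl !mulrBr !scaleAl !scaleAr scalerA sqr_c scaleN1r opprK c12.
rewrite scalerDr scalerA sqr_c scaleN1r opprD opprK.
move: (O1 * O1) (O2 * O2) (c *: (O2 * O1)) => A B D.
by rewrite -!addrA; congr (A + _); rewrite [C + _]addrCA addKr addrC.
Qed.

Let commPQ : P * Q - Q * P = C *+ 2.
Proof.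
rewrite PQ QP; move: (_ + O2 * O2) => A.
by rewrite opprB [A + C]addrC addrACA subrr addr0 mulr2n.
Qed.

Let C1 : C * O1 = O1 * C + c *: O2.
Proof. by apply/eqP; rewrite addrC -subr_eq -opprB [_ - _]comm1 scaleNr opprK. Qed.

Let C2 : C * O2 = O2 * C - c *: O1.
Proof. by apply/eqP; rewrite addrC -subr_eq -opprB [_ - _]comm2. Qed.

Let CP : C * P = P * C + P.
Proof.
rewrite /P mulrDr mulrDl scaleAl scaleAr C1 C2 scalerBr scalerA sqr_c scaleN1r opprK.
by rewrite addrACA [_ + O1]addrC.
Qed.

Let CQ : C * Q = Q * C - Q.
Proof.
rewrite /Q mulrBr mulrBl scaleAl scaleAr C1 C2 scalerBr scalerA sqr_c scaleN1r opprK.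
by rewrite opprD addrACA opprB.
Qed.

Let loc := local_sum o1 o2 S.

Let lower_boundN x v : ketnorm ((o1 x + (- c) *: o2 x) *m v) <= o0 * ketnorm v.
Proof. by rewrite scaleNr. Qed.

Let QE : Q = \sum_x (o1 x + (- c) *: o2 x).
Proof. by rewrite /Q -scaleNr big_split /= -scaler_sumr. Qed.

Let locP b B : loc b B -> loc (g * b) (P * B - B * P).
Proof.
rewrite PE; exact: (local_sum_commutator comm_sites o0_ge0 _ card_S raise_bound).
Qed.

Let locQ b B : loc b B -> loc (g * b) (Q * B - B * Q).
Proof.
rewrite QE; exact: (local_sum_commutator comm_sites o0_ge0 _ card_S lower_boundN).
Qed.

Let V_neq0 : V != 0. Proof. by rewrite /V pnatr_eq0 -lt0n. Qed.

Let loc_H : loc (h0 * V) H.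
Proof.
split; first by rewrite mulr_ge0.
by exists h; split=> // x v; rewrite -/V mulfK.
Qed.

Let loc_HE : loc (g * (h0 * V)) (P * (H - E%:C%:M) - (H - E%:C%:M) * P).
Proof.
have <- : P * H - H * P = P * (H - E%:C%:M) - (H - E%:C%:M) * P; last exact: locP.
have scalarC : P * E%:C%:M = E%:C%:M * P by exact: scalar_mxC.
rewrite mulrBr mulrBl scalarC; move: (P * H) (H * P) (_ * P) => A B D.
by rewrite opprB addrA subrK.
Qed.

(* The charge is half of [P Q - Q P], a sum of single-site commutators. *)
Let mu_le : `|mu| <= o0 ^+ 2 * V.
Proof.
(* With singletons as supports the commutator lemma applies with [zeta = 1], so [[P, Q]] has norm at
   most [2 o0^2 V], while it acts on [phi] as [2 mu]. *)
have locQ1 : local_sum o1 o2 (fun x => [set x]) (o0 * V) Q.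
  split; first by rewrite mulr_ge0.
  exists (fun x => o1 x + (- c) *: o2 x); split; first exact: QE.
    by move=> x v; rewrite -/V mulfK.
  move=> x z; rewrite inE => zx.
  have [h1 h2 h3] := comm_sites zx; rewrite eq_sym in zx; have [_ h4 _] := comm_sites zx.
  by rewrite !mulrDl !mulrDr !scaleAl !scaleAr -h1 -h2 h3 h4.
have card1 x : (#|[set x : X]| <= 1)%N by rewrite cards1.
have locC := local_sum_commutator comm_sites o0_ge0 (fun=> erefl) card1 raise_bound locQ1.
have := local_sum_bound phi X_gt0 locC.
rewrite -PE commPQ phi1 mulr1 mulr2n mulmxDl Cphi -scalerDl -rmorphD ketnormZ cabsC phi1.
have -> : 2 * 1 * o0 * (o0 * V) = 2 * (o0 ^+ 2 * V) by ring.
have -> : mu + mu = 2 * mu by ring.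
by rewrite mulr1 normrM ger0_norm // ler_pM2l.
Qed.

(** Long-range order enters here: [Q P = O1^2 + O2^2 - C], and each square has expectation at least
    [q0 V^2]. *)
Let norm_P : 2 * (q0 * V ^+ 2) - `|mu| <= ketnorm (P *m phi) ^+ 2.
Proof.
rewrite -lecR sqr_ketnorm.
have -> : braket (P *m phi) (P *m phi) =
    expval phi (O1 * O1) + expval phi (O2 * O2) - mu%:C.
  have -> : braket (P *m phi) (P *m phi) = braket phi ((Q * P) *m phi).
    by rewrite -mulmxA [RHS]braket_adj -adjP trmxCK.
  rewrite QP mulmxBl mulmxDl braketBr braketDr Cphi braketZr -sqr_ketnorm phi1.
  by rewrite expr1n mulr1.
rewrite rmorphB mulrDl mul1r rmorphD lerB ?lerD //.
by rewrite lecR ler_norm.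
Qed.

(** [tower_bound] is applied to [H - E], which annihilates [phi], with [tau = q0 V^2] and
    [b0 = h0 V]. *)
Lemma local_tower (K : nat) : (0 < K)%N ->
  K%:R <= tower_radius o0 g q0 * Num.sqrt V ->
  let v := P ^+ K *m phi in
  [/\ v != 0,
      braket v (H *m v) <=
        (ketnorm v ^+ 2 * (E + cubic_rate o0 g h0 q0 * (K%:R ^+ 3 / V)))%:C
    & mu = 0 -> braket v (H *m v) <=
        (ketnorm v ^+ 2 * (E + quadratic_rate g h0 q0 * (K%:R ^+ 2 / V)))%:C].
Proof.
move=> K0 hK v.
have g_ge0 : 0 <= g by rewrite !mulr_ge0.
have K1 : 1 <= K%:R :> R by rewrite ler1n.
have [t1 t2 t3] := tower_conditions g_ge0 q0_gt0 V_ge1 K1 hK mu_le.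
have cub := cubic_bound g_ge0 h0_ge0 q0_gt0 V_ge1 K1 hK mu_le.
have quad := quadratic_bound g_ge0 h0_ge0 q0_gt0 V_ge1 K1 hK.
have tau_gt0 : 0 < q0 * V ^+ 2 by rewrite mulr_gt0 // exprn_gt0 // (lt_le_trans ltr01).
have adjHE : (H - E%:C%:M)^t* = H - E%:C%:M.
  have adjB (A B : 'M[R[i]]_N) : (A - B)^t* = A^t* - B^t*.
    by apply/matrixP => a b; rewrite !mxE rmorphB.
  rewrite adjB adjH; congr (_ - _); apply/matrixP => a b; rewrite !mxE.
  rewrite eq_sym; case: eqP => _; rewrite ?mulr0n ?rmorph0 // mulr1n.
  by apply/conj_Creal/complex_realP; exists E.
have HEphi : (H - E%:C%:M) *m phi = 0.
  by rewrite mulmxBl Hphi mul_scalar_mx subrr.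
have CHE : C * (H - E%:C%:M) = (H - E%:C%:M) * C.
  rewrite mulrBr mulrBl; congr (_ - _); last exact: scalar_mxC.
  by apply/eqP; rewrite -subr_eq0; apply/eqP.
have b0_ge0 : 0 <= h0 * V by rewrite mulr_ge0.
have loc_b b B u : loc b B -> ketnorm (B *m u) <= b * ketnorm u.
  exact: local_sum_bound.
have [pos energy] := tower_bound adjP commPQ CP CQ CHE Cphi HEphi adjHE phi1 g_ge0
  b0_ge0 loc_b locP locQ loc_HE tau_gt0 norm_P t1 t2 t3 K0 gap.
rewrite -/v in pos energy.
have add_E x : braket v ((H - E%:C%:M) *m v) <= (ketnorm v ^+ 2 * x)%:C ->
    braket v (H *m v) <= (ketnorm v ^+ 2 * (E + x))%:C.
  rewrite mulmxBl mul_scalar_mx braketBr braketZr -sqr_ketnorm lerBlDr.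
  by rewrite -rmorphM -rmorphD mulrDr [E * _]mulrC addrC.
have scale_le x y : x <= y -> (ketnorm v ^+ 2 * x)%:C <= (ketnorm v ^+ 2 * y)%:C.
  by move=> xy; rewrite lecR ler_wpM2l ?sqr_ge0.
split.
- by apply: contraTneq pos => ->; rewrite ketnorm0 expr0n ltxx.
- by apply: add_E; apply: le_trans energy _; apply: scale_le cub.
- by move=> mu0; apply: add_E; apply: le_trans energy _; apply: scale_le (quad _ mu0).
Qed.

End LocalTower.

(** * From the lattice model to the abstract tower *)

Lemma le_complex_div (R : realType) (x y : R) (z : R[i]) : 0 < y ->
  x%:C <= y^-1%:C * z -> (x * y)%:C <= z.
Proof.
move=> y0 le_x; have y1 : 0 < y%:C by rewrite -(rmorph0 (real_complex R)) ltcR.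
by rewrite rmorphM mulrC -ler_pdivlMl // -fmorphV.
Qed.

Lemma comm_sum (R : realType) (N : nat) (X : finType) (A : 'M[R[i]]_N)
    (f : X -> 'M[R[i]]_N) :
  (forall x, comm A (f x) = 0) -> comm A (\sum_x f x) = 0.
Proof.
by move=> Af; rewrite /comm mulmx_sumr mulmx_suml -sumrB big1 // => x _; exact: Af.
Qed.

Section LatticeTower.
Variables (R : realType) (d n L : nat) (m : model R d n L).
Variables (a h0 o0 q0 : R) (zeta : nat).
Hypotheses (L_gt1 : (1 < L)%N) (q0_gt0 : 0 < q0) (Hm : assumptions m a zeta h0 o0 q0).
Let V : R := (volume d L)%:R.
Let g := 2 * zeta%:R * `|o0|.

Lemma card_site : #|{: site d L}| = volume d L.
Proof. by rewrite card_ffun !card_ord Zp_cast. Qed.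

Let V_gt0 : 0 < V.
Proof. by rewrite ltr0n expn_gt0 (ltnW L_gt1). Qed.

Let expval_scale v (A : operator R d n L) :
  expval v (((volume d L)%:R^-1 *: A) ^+ 2) = (V ^- 2)%:C * expval v (A * A).
Proof.
have -> : (volume d L)%:R^-1 = (V^-1)%:C :> R[i].
  by rewrite /V fmorphV rmorph_nat.
have scale2 (z : R[i]) (B : operator R d n L) : (z *: B) * (z *: B) = (z * z) *: (B * B).
  rewrite -scalerA; apply: etrans (esym (scalemxAl _ _ _)) _; congr (_ *: _).
  exact: esym (scalemxAr _ _ _).
by rewrite expr2 /expval scale2 -rmorphM -expr2 exprVn -scalemxAl braketZr.
Qed.

Lemma lattice_tower (K : nat) (up : bool) : (0 < K)%N ->
  K%:R <= tower_radius `|o0| g q0 * Num.sqrt V ->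
  let v := (if up then OrdP m else OrdM m) ^+ K *m gs m in
  [/\ v != 0,
      braket v (Ham m *m v) <=
        (ketnorm v ^+ 2 * (gsE m + cubic_rate `|o0| g `|h0| q0 * (K%:R ^+ 3 / V)))%:C
    & gsM m = 0 -> braket v (Ham m *m v) <=
        (ketnorm v ^+ 2 * (gsE m + quadratic_rate g `|h0| q0 * (K%:R ^+ 2 / V)))%:C].
Proof.
have [[Hh _ Elow] [[_ hC _ _] [Hherm _ c1 c2 c12] A3m [[gs1 gsE1 _] gsC] [q12 q1]]] := Hm.
have [hloc oloc hnorm onorm] := A3m.
move=> K0 hK.
have [S hS] := fin_all_exists hloc.
have adj1 x : (local1 m x)^t* = local1 m x by apply: hermsymmx_adj; have [] := Hherm x.
have adj2 x : (local2 m x)^t* = local2 m x by apply: hermsymmx_adj; have [] := Hherm x.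
have comm_sites z w : z != w ->
    [/\ local1 m z * local1 m w = local1 m w * local1 m z,
        local1 m z * local2 m w = local2 m w * local1 m z &
        local2 m z * local2 m w = local2 m w * local2 m z].
  move=> zw; have [z1 z2] := oloc z; have [w1 w2] := oloc w.
  have dzw : [disjoint [set z] & [set w]] by rewrite disjoints1 inE.
  by split; apply: acts_on_commute dzw _ _.
have card_S x : (#|S x| <= zeta)%N by have [] := hS x.
have h_local x z : z \notin S x -> ham m x * local1 m z = local1 m z * ham m x /\
    ham m x * local2 m z = local2 m z * ham m x.
  move=> zS; have [_ _ hx] := hS x; have [z1 z2] := oloc z.
  have dxz : [disjoint S x & [set z]] by rewrite disjoint_sym disjoints1.
  by split; apply: acts_on_commute dxz _ _.
have h_bound x v : ketnorm (ham m x *m v) <= `|h0| * ketnorm v.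
  apply: le_trans (opnormP _ _) _; rewrite hnorm.
  by apply: ler_wpM2r; [exact: ketnorm_ge0 | exact: ler_norm].
have le_o0 (A : operator R d n L) v : opnorm A = o0 -> ketnorm (A *m v) <= `|o0| * ketnorm v.
  move=> oA; apply: le_trans (opnormP _ _) _; rewrite oA.
  by apply: ler_wpM2r; [exact: ketnorm_ge0 | exact: ler_norm].
have raise_bound x v := le_o0 _ v (proj1 (onorm x)).
have lower_bound x v := le_o0 _ v (proj2 (onorm x)).
have X0 : (0 < #|{: site d L}|)%N by rewrite card_site expn_gt0 ltnW.
have phi1 : ketnorm (gs m) = 1 by rewrite /ketnorm gs1 sqrtr1.
have order (A : operator R d n L) : q0%:C <= expval (gs m) (((volume d L)%:R^-1 *: A) ^+ 2) ->
    (q0 * #|{: site d L}|%:R ^+ 2)%:C <= expval (gs m) (A * A).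
  by rewrite expval_scale card_site; apply: le_complex_div; exact: exprn_gt0.
have CH : comm (charge m) (Ham m) = 0 by exact: comm_sum hC.
have ii : 'i * 'i = -1 :> R[i] by rewrite -expr2 sqr_i.
have conj_i : Num.conj ('i : R[i]) = - 'i.
  by apply/eqP; rewrite eq_complex /= oppr0 !eqxx.
have gap v := lowest_eigenvalue_le v Hh Elow.
have order1 := order _ q1.
have order2 := order _ (eq_ind _ (fun z => q0%:C <= z) q1 _ q12).
rewrite /V -card_site in hK *.
have tower_c := local_tower adj1 adj2 comm_sites card_S h_local h_bound X0
  (normr_ge0 o0) (normr_ge0 h0) q0_gt0 (hermsymmx_adj Hh) phi1 gsE1 gap order1 order2.
case: up.
  exact: (tower_c _ _ (gsM m) conj_i ii c1 c2 c12 CH gsC raise_bound lower_bound K K0 hK).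
have conj_Ni : Num.conj (- 'i : R[i]) = - - 'i.
  by apply/eqP; rewrite eq_complex /= !oppr0 !eqxx.
have iiN : - 'i * - 'i = -1 :> R[i] by rewrite mulrNN.
have commNr (A B : operator R d n L) : comm A (- B) = - comm A B.
  by rewrite /comm mulmxN mulNmx opprK opprB addrC.
have commNl (A B : operator R d n L) : comm (- A) B = - comm A B.
  by rewrite /comm mulmxN mulNmx opprK opprB addrC.
have comm1N : comm (Ord1 m) (- charge m) = - - 'i *: Ord2 m.
  by rewrite commNr c1 opprK scaleNr opprK.
have comm2N : comm (Ord2 m) (- charge m) = - 'i *: Ord1 m.
  by rewrite commNr c2 scaleNr.
have comm12N : comm (Ord1 m) (Ord2 m) = - 'i *: - charge m.
  by rewrite c12 scalerN scaleNr opprK.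
have CHN : comm (- charge m) (Ham m) = 0 by rewrite commNl CH oppr0.
have gsCN : (- charge m) *m gs m = (- gsM m)%:C *: gs m.
  by rewrite mulNmx gsC rmorphN scaleNr.
have raiseN x v : ketnorm ((local1 m x + - 'i *: local2 m x) *m v) <= `|o0| * ketnorm v.
  by rewrite scaleNr.
have lowerN x v : ketnorm ((local1 m x - - 'i *: local2 m x) *m v) <= `|o0| * ketnorm v.
  by rewrite scaleNr opprK.
have -> : OrdM m = Ord1 m + - 'i *: Ord2 m by rewrite scaleNr.
have [r1 r2 r3] := tower_c _ _ (- gsM m) conj_Ni iiN comm1N comm2N comm12N CHN gsCN
  raiseN lowerN K K0 hK.
split; [exact: r1 | exact: r2 |].
by move=> M0; apply: r3; rewrite M0 oppr0.
Qed.

End LatticeTower.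

(** * Normalized states and the final choice of constants *)

Lemma expval_normalized (R : realType) (N : nat) (A : 'M[R[i]]_N) v (x : R) : v != 0 ->
  braket v (A *m v) <= (ketnorm v ^+ 2 * x)%:C ->
  expval ((ketnorm v)^-1%:C *: v) A <= x%:C.
Proof.
move=> v0 le_x; have nv0 : ketnorm v != 0.
  by apply: contraNneq v0 => /ketnorm_eq0 ->.
have r0 : 0 <= ((ketnorm v)^-1 * (ketnorm v)^-1)%:C.
  by rewrite ler0c mulr_ge0 // invr_ge0 ketnorm_ge0.
have := ler_wpM2l r0 le_x; rewrite -rmorphM.
have -> : (ketnorm v)^-1 * (ketnorm v)^-1 * (ketnorm v ^+ 2 * x) = x by field.
apply: le_trans; rewrite /expval -scalemxAr braketZr braketZl mulrA.
have -> : Num.conj (ketnorm v)^-1%:C = (ketnorm v)^-1%:C :> R[i].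
  by apply/conj_Creal/complex_realP; exists (ketnorm v)^-1.
by rewrite rmorphM.
Qed.

Theorem theorem3p1 (R : realType) (o0 h0 q0 : R) (zeta : nat) (hq0 : 0 < q0) :
  exists C1 C2 C3 : R, [/\ 0 < C1, 0 < C2 & 0 < C3] /\
  forall (d n : nat) (a : R) (m : forall L : nat, model R d n L),
    (0 < d)%N -> 0 < a ->
    (forall L : nat, (0 < L)%N -> ~~ odd L ->
       assumptions (m L) a zeta h0 o0 q0) ->
  forall (L : nat) (M : int),
    (0 < L)%N -> ~~ odd L -> M != 0 ->
    `|M|%:~R <= C1 * Num.sqrt (volume d L)%:R ->
    [/\ tower_num (m L) M != 0,
        expval (tower (m L) M) (Ham (m L)) <=
          (gsE (m L) + C3 * (`|M|%:~R ^+ 3 / (volume d L)%:R))%:C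
      & gsM (m L) = 0 ->
        expval (tower (m L) M) (Ham (m L)) <=
          (gsE (m L) + C2 * (M%:~R ^+ 2 / (volume d L)%:R))%:C].
Proof.
pose g := 2 * zeta%:R * `|o0|.
have g_ge0 : 0 <= g by rewrite !mulr_ge0.
(* The constants are fixed before any model is given, when [o0] and [h0] are arbitrary reals;
   absolute values keep the constants positive and still bound the operator norms. *)
exists (tower_radius `|o0| g q0), (quadratic_rate g `|h0| q0), (cubic_rate `|o0| g `|h0| q0).
split; first by split; [exact: tower_radius_gt0 | exact: quadratic_rate_gt0
  | exact: cubic_rate_gt0].
move=> d n a m _ _ Hm L M L_gt0 L_even M0 hM.
(* A positive even [L] is at least [2], so ['Z_L] has exactly [L] elements and the lattice has
   [volume d L] sites. *)
have L_gt1 : (1 < L)%N by case: L L_gt0 L_even {hM} => [|[]].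
have normM : `|M|%:~R = `|M|%N%:R :> R by rewrite -abszE.
have sqrM : M%:~R ^+ 2 = `|M|%N%:R ^+ 2 :> R.
  by rewrite -normM intr_norm real_normK ?num_real.
rewrite normM in hM *; rewrite sqrM.
have K0 : (0 < `|M|)%N by rewrite absz_gt0.
have numE : tower_num (m L) M =
    (if 0 <= M then OrdP (m L) else OrdM (m L)) ^+ `|M|%N *m gs (m L).
  by rewrite /tower_num; case: ifP.
have [num0 cub quad] := lattice_tower L_gt1 hq0 (Hm L L_gt0 L_even) (0 <= M) K0 hM.
rewrite -numE in num0 cub quad.
split; first exact: num0.
- exact: expval_normalized num0 cub.
- by move=> M_eq0; apply: expval_normalized num0 (quad M_eq0).
Qed.
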